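(* Consider problem (P): $\min_{x\in H} f(x)+g(x)+\sum_{i=1}^m h_i(B_ix)$ under the standing assumptions below. Let $\gamma\in(0,2/L)$ and $0<\lambda<1/\sum_{i=1}^m\|B_i\|^2$. Given arbitrary $x^0\in H$ and $y_i^0\in G_i$ ($i=1,\dots,m$), define for $k\ge0$ $$v^k=\operatorname{prox}_{\gamma g}\Big(x^k-\gamma\nabla f(x^k)-\gamma\sum_{i=1}^m B_i^*y_i^k\Big),$$ $$y_i^{k+1}=\operatorname{prox}_{\frac{\lambda}{\gamma}h_i^*}\Big(y_i^k+\tfrac{\lambda}{\gamma}B_iv^k\Big),\quad i=1,\dots,m,$$ $$x^{k+1}=\operatorname{prox}_{\gamma g}\Big(x^k-\gamma\nabla f(x^k)-\gamma\sum_{i=1}^m B_i^*y_i^{k+1}\Big).$$ Then $\{x^k\}$ converges weakly to a solution of (P).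
   Context: Standing assumptions: $H$ and $G_1,\dots,G_m$ are real Hilbert spaces; $f:H\to\mathbb R$ is convex and differentiable with $L$-Lipschitz continuous gradient for some $L\in(0,\infty)$; $g\in\Gamma_0(H)$; $h_i\in\Gamma_0(G_i)$ and $B_i:H\to G_i$ is a bounded linear operator for each $i$; there exists $\hat x\in H$ with $0\in\nabla f(\hat x)+\partial g(\hat x)+\sum_{i=1}^m B_i^*\partial h_i(B_i\hat x)$. $\Gamma_0(X)$ is the set of proper lsc convex functions on $X$; $\operatorname{prox}_{\lambda\varphi}(u)=\arg\min_x\{\tfrac12\|x-u\|^2+\lambda\varphi(x)\}$; $\varphi^*$ is the Fenchel conjugate; $B_i^*$ is the adjoint of $B_i$ and $\|B_i\|$ its operator norm. *)

(* Defs.v *)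
From Stdlib Require Import Reals Lra Classical ClassicalEpsilon.
Open Scope R_scope.
Set Implicit Arguments.

Record Hilbert := {
  hcar :> Type;
  hzero : hcar;
  hadd : hcar -> hcar -> hcar;
  hopp : hcar -> hcar;
  hscal : R -> hcar -> hcar;
  hinner : hcar -> hcar -> R;
  h_addA : forall x y z, hadd x (hadd y z) = hadd (hadd x y) z;
  h_addC : forall x y, hadd x y = hadd y x;
  h_add0 : forall x, hadd x hzero = x;
  h_addN : forall x, hadd x (hopp x) = hzero;
  h_scalA : forall a b x, hscal a (hscal b x) = hscal (a * b) x;
  h_scal1 : forall x, hscal 1 x = x;
  h_scalDr : forall a x y, hscal a (hadd x y) = hadd (hscal a x) (hscal a y);
  h_scalDl : forall a b x, hscal (a + b) x = hadd (hscal a x) (hscal b x);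
  h_innerC : forall x y, hinner x y = hinner y x;
  h_innerD : forall x y z, hinner (hadd x y) z = hinner x z + hinner y z;
  h_innerZ : forall a x y, hinner (hscal a x) y = a * hinner x y;
  h_inner_pos : forall x, 0 <= hinner x x;
  h_inner_def : forall x, hinner x x = 0 -> x = hzero;
  h_complete : forall u : nat -> hcar,
    (forall eps, eps > 0 -> exists N, forall p q, (p >= N)%nat -> (q >= N)%nat ->
        sqrt (hinner (hadd (u p) (hopp (u q))) (hadd (u p) (hopp (u q)))) < eps) ->
    exists l, forall eps, eps > 0 -> exists N, forall n, (n >= N)%nat ->
        sqrt (hinner (hadd (u n) (hopp l)) (hadd (u n) (hopp l))) < eps
}.
Arguments hzero {h}.
Arguments hadd {h}.
Arguments hopp {h}.
Arguments hscal {h}.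
Arguments hinner {h}.

Definition hsub {X : Hilbert} (x y : X) : X := hadd x (hopp y).
Definition hnorm {X : Hilbert} (x : X) : R := sqrt (hinner x x).

Fixpoint hsum {X : Hilbert} (m : nat) (F : nat -> X) : X :=
  match m with O => hzero | S n => hadd (hsum n F) (F n) end.
Fixpoint rsum (m : nat) (F : nat -> R) : R :=
  match m with O => 0 | S n => rsum n F + F n end.

Inductive ERbar := Fin (r : R) | PInf.

Definition ele (a b : ERbar) : Prop :=
  match a, b with
  | Fin x, Fin y => x <= y
  | _, PInf => True
  | PInf, Fin _ => False
  end.

Definition eadd (a b : ERbar) : ERbar :=
  match a, b with Fin x, Fin y => Fin (x + y) | _, _ => PInf end.

Fixpoint esum (m : nat) (F : nat -> ERbar) : ERbar :=
  match m with O => Fin 0 | S n => eadd (esum n F) (F n) end.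

Definition proper {X : Hilbert} (phi : X -> ERbar) : Prop :=
  exists x, phi x <> PInf.

Definition convex_fun {X : Hilbert} (phi : X -> ERbar) : Prop :=
  forall x y a b t, 0 < t < 1 -> phi x = Fin a -> phi y = Fin b ->
    ele (phi (hadd (hscal t x) (hscal (1 - t) y))) (Fin (t * a + (1 - t) * b)).

Definition strong_cv {X : Hilbert} (u : nat -> X) (l : X) : Prop :=
  forall eps, eps > 0 -> exists N, forall n, (n >= N)%nat -> hnorm (hsub (u n) l) < eps.

(* lower semicontinuity: all sublevel sets are (sequentially) closed *)
Definition lsc {X : Hilbert} (phi : X -> ERbar) : Prop :=
  forall (a : R) (u : nat -> X) (l : X),
    (forall n, ele (phi (u n)) (Fin a)) -> strong_cv u l -> ele (phi l) (Fin a).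

Definition Gamma0 {X : Hilbert} (phi : X -> ERbar) : Prop :=
  proper phi /\ convex_fun phi /\ lsc phi.

Definition is_esup (S : R -> Prop) (s : ERbar) : Prop :=
  match s with
  | Fin r => is_lub S r
  | PInf => forall M, exists t, S t /\ M < t
  end.

Definition fconj {X : Hilbert} (phi : X -> ERbar) (y : X) : ERbar :=
  epsilon (inhabits PInf)
    (fun s => is_esup (fun t => exists x a, phi x = Fin a /\ t = hinner y x - a) s).

Definition prox_obj {X : Hilbert} (c : R) (phi : X -> ERbar) (u x : X) : ERbar :=
  match phi x with
  | Fin a => Fin (/2 * (hnorm (hsub x u))^2 + c * a)
  | PInf => PInf
  end.

Definition prox {X : Hilbert} (c : R) (phi : X -> ERbar) (u : X) : X :=
  epsilon (inhabits u)
    (fun p => forall x, ele (prox_obj c phi u p) (prox_obj c phi u x)).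

Definition is_gradient {X : Hilbert} (f : X -> R) (df : X -> X) : Prop :=
  forall x eps, eps > 0 -> exists delta, delta > 0 /\
    forall h : X, hnorm h < delta ->
      Rabs (f (hadd x h) - f x - hinner (df x) h) <= eps * hnorm h.

Definition lipschitz {X : Hilbert} (L : R) (F : X -> X) : Prop :=
  forall x y, hnorm (hsub (F x) (F y)) <= L * hnorm (hsub x y).

Definition bounded_linear {X Y : Hilbert} (B : X -> Y) : Prop :=
  (forall x y, B (hadd x y) = hadd (B x) (B y)) /\
  (forall a x, B (hscal a x) = hscal a (B x)) /\
  (exists C, forall x, hnorm (B x) <= C * hnorm x).

Definition is_adjoint {X Y : Hilbert} (B : X -> Y) (Bs : Y -> X) : Prop :=
  forall x y, hinner (B x) y = hinner x (Bs y).

Definition op_norm {X Y : Hilbert} (B : X -> Y) : R :=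
  epsilon (inhabits 0)
    (fun r => is_lub (fun t => exists x, hnorm x <= 1 /\ t = hnorm (B x)) r).

Definition subdiff {X : Hilbert} (phi : X -> ERbar) (x u : X) : Prop :=
  exists a, phi x = Fin a /\
    forall y, ele (Fin (a + hinner u (hsub y x))) (phi y).

Definition weak_cv {X : Hilbert} (u : nat -> X) (l : X) : Prop :=
  forall z : X, Un_cv (fun k => hinner (u k) z) (hinner l z).

(* Main.v *)
(** Let [u^k = (x^k, y^k)]. By Moreau's decomposition, the three proximal steps are inclusions for
    [\partial g] and [\partial h_i] alone, so the conjugates [h_i^*] disappear. Stacking the [h_i] and
    [B_i] into one function [h] and one operator [B] on the product space, every saddle point
    [(xs, ys)] satisfies, by cocoercivity of the gradient and Young's inequality,
    [|x^{k+1} - xs|^2 + (gamma^2/lambda) |y^{k+1} - ys|^2 + a |x^k - v^k|^2 + b |v^k - x^{k+1}|^2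
       + c |y^{k+1} - y^k|^2 <= |x^k - xs|^2 + (gamma^2/lambda) |y^k - ys|^2]
    with [a, b, c > 0]; hence the distances to saddle points converge and the residuals vanish.
    Being a saddle point is a family of affine inequalities in [(xs, ys)], indexed by subgradients
    of [g] and [h]; each holds at [u^k] up to a vanishing error, hence exactly at every point of all
    closed convex hulls of the tails of any subsequence of [u^k]. Such points exist by completeness,
    and Opial's argument applies to them, so no weak compactness is needed. *)

Require Import Defs.
From Stdlib Require Import Reals Lra Lia Psatz Classical ClassicalEpsilon.
Open Scope R_scope.
Set Implicit Arguments.
Unset Strict Implicit.

(** * Inner product algebra, Cauchy-Schwarz and norms *)

Lemma inner_addr (X : Hilbert) (x y z : X) : hinner z (hadd x y) = hinner z x + hinner z y.
Proof. rewrite h_innerC, h_innerD, (h_innerC _ x), (h_innerC _ y); ring. Qed.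

Lemma inner_scalr (X : Hilbert) (a : R) (x y : X) : hinner x (hscal a y) = a * hinner x y.
Proof. rewrite h_innerC, h_innerZ, h_innerC; ring. Qed.

Lemma inner_0l (X : Hilbert) (x : X) : hinner hzero x = 0.
Proof. pose proof (h_innerD _ hzero hzero x) as E. rewrite h_add0 in E. lra. Qed.

Lemma inner_0r (X : Hilbert) (x : X) : hinner x hzero = 0.
Proof. rewrite h_innerC; apply inner_0l. Qed.

Lemma inner_oppl (X : Hilbert) (x y : X) : hinner (hopp x) y = - hinner x y.
Proof.
  pose proof (h_innerD _ x (hopp x) y) as E. rewrite h_addN, inner_0l in E. lra.
Qed.

Lemma inner_oppr (X : Hilbert) (x y : X) : hinner x (hopp y) = - hinner x y.
Proof. rewrite h_innerC, inner_oppl, h_innerC; ring. Qed.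

Ltac hexp :=
  unfold hsub;
  repeat rewrite ?h_innerD, ?inner_addr, ?h_innerZ, ?inner_scalr, ?inner_oppl,
    ?inner_oppr, ?inner_0l, ?inner_0r.

(** Leaves one orientation of each product, so that linear arithmetic treats [hinner a b] and
    [hinner b a] as one atom. *)
Ltac hsym :=
  repeat match goal with
  | |- context [hinner ?a ?b] =>
      match goal with
      | |- context [hinner b a] => tryif constr_eq a b then fail else rewrite (h_innerC _ b a)
      end
  end.

(** Testing with [z = x - y] gives a vector of norm zero. Vector identities thus become scalar ring
    identities, which is what [vec] exploits. *)
Lemma hext (X : Hilbert) (x y : X) : (forall z, hinner x z = hinner y z) -> x = y.
Proof.
  intros E.
  assert (Z : hadd x (hopp y) = hzero).
  { apply h_inner_def. rewrite h_innerD, inner_oppl, E. ring. }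
  assert (T : hadd (hadd x (hopp y)) y = x).
  { rewrite <- h_addA, (h_addC _ (hopp y)), h_addN, h_add0; reflexivity. }
  rewrite <- T, Z, h_addC, h_add0. reflexivity.
Qed.

Ltac vec := apply hext; let z := fresh in intro z; hexp; try ring.

Lemma hsub_eq0 (X : Hilbert) (x y : X) : hinner (hsub x y) (hsub x y) = 0 -> x = y.
Proof.
  intros E. apply h_inner_def in E. apply hext. intro z.
  assert (T : hinner (hsub x y) z = 0) by (rewrite E; apply inner_0l).
  revert T. hexp. lra.
Qed.

Lemma hnorm_sq (X : Hilbert) (x : X) : hnorm x * hnorm x = hinner x x.
Proof. apply sqrt_sqrt, h_inner_pos. Qed.

Lemma hnorm_ge0 (X : Hilbert) (x : X) : 0 <= hnorm x.
Proof. apply sqrt_pos. Qed.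

Lemma cauchy_schwarz_sq (X : Hilbert) (x y : X) :
  hinner x y * hinner x y <= hinner x x * hinner y y.
Proof.
  destruct (Req_dec (hinner y y) 0) as [E|E].
  - apply h_inner_def in E. subst y. rewrite !inner_0r. lra.
  - assert (P : 0 < hinner y y) by (pose proof (h_inner_pos _ y); lra).
    (* The squared norm of this vector is [<y,y>] times [<x,x><y,y> - <x,y>^2]. *)
    pose proof (h_inner_pos _ (hadd (hscal (hinner y y) x) (hscal (- hinner x y) y))) as Q.
    revert Q. hexp. hsym. intro Q. nra.
Qed.

Lemma cauchy_schwarz (X : Hilbert) (x y : X) : Rabs (hinner x y) <= hnorm x * hnorm y.
Proof.
  apply Rsqr_incr_0_var.
  - rewrite <- Rsqr_abs. unfold Rsqr.
    pose proof (cauchy_schwarz_sq x y) as C.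
    rewrite <- (hnorm_sq x), <- (hnorm_sq y) in C. lra.
  - apply Rmult_le_pos; apply hnorm_ge0.
Qed.

Lemma hinner_le (X : Hilbert) (x y : X) : hinner x y <= hnorm x * hnorm y.
Proof. eapply Rle_trans; [apply Rle_abs | apply cauchy_schwarz]. Qed.

Lemma hnorm_le (X : Hilbert) (x : X) (c : R) : 0 <= c -> hinner x x <= c * c -> hnorm x <= c.
Proof. intros P E. rewrite <- hnorm_sq in E. pose proof (hnorm_ge0 x). nra. Qed.

Lemma hnorm_add (X : Hilbert) (x y : X) : hnorm (hadd x y) <= hnorm x + hnorm y.
Proof.
  pose proof (hnorm_ge0 x). pose proof (hnorm_ge0 y).
  apply hnorm_le; [lra|].
  pose proof (hinner_le x y). pose proof (hnorm_sq x). pose proof (hnorm_sq y).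
  hexp. hsym. nra.
Qed.

Lemma hnorm_scal (X : Hilbert) (a : R) (x : X) : hnorm (hscal a x) = Rabs a * hnorm x.
Proof.
  unfold hnorm. rewrite h_innerZ, inner_scalr, <- Rmult_assoc.
  rewrite sqrt_mult by (try apply h_inner_pos; nra).
  f_equal. apply sqrt_Rsqr_abs.
Qed.

Lemma hnorm_0 (X : Hilbert) : hnorm (@hzero X) = 0.
Proof. unfold hnorm. rewrite inner_0l. apply sqrt_0. Qed.

(** * Bounded and vanishing sequences *)

Definition bdd {X : Hilbert} (s : nat -> X) : Prop := exists M, forall k, hnorm (s k) <= M.
Definition vanish {X : Hilbert} (s : nat -> X) : Prop := Un_cv (fun k => hnorm (s k)) 0.

Lemma bdd_const (X : Hilbert) (x : X) : bdd (fun _ => x).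
Proof. exists (hnorm x). intros; lra. Qed.

Lemma bdd_add (X : Hilbert) (s t : nat -> X) :
  bdd s -> bdd t -> bdd (fun k => hadd (s k) (t k)).
Proof.
  intros [M HM] [N HN]. exists (M + N). intro k.
  pose proof (hnorm_add (s k) (t k)). specialize (HM k). specialize (HN k). lra.
Qed.

Lemma bdd_scal (X : Hilbert) (a : R) (s : nat -> X) : bdd s -> bdd (fun k => hscal a (s k)).
Proof.
  intros [M HM]. exists (Rabs a * M). intro k. rewrite hnorm_scal.
  apply Rmult_le_compat_l; [apply Rabs_pos | apply HM].
Qed.

Lemma Un_cv_ext (u v : nat -> R) (l : R) : (forall n, u n = v n) -> Un_cv u l -> Un_cv v l.
Proof. intros E H eps P. destruct (H eps P) as [N HN]. exists N. intros n Hn. rewrite <- E. auto. Qed.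

Lemma Un_cv_cst (c : R) : Un_cv (fun _ => c) c.
Proof. intros eps P. exists 0%nat. intros. unfold Rdist. rewrite Rminus_diag, Rabs_R0. lra. Qed.

Lemma Un_cv_scal (u : nat -> R) (c l : R) : Un_cv u l -> Un_cv (fun k => c * u k) (c * l).
Proof. intro C. apply (CV_mult _ _ _ _ (Un_cv_cst c) C). Qed.

Lemma Un_cv_squeeze0 (u v : nat -> R) :
  (forall k, Rabs (u k) <= v k) -> Un_cv v 0 -> Un_cv u 0.
Proof.
  intros E C eps P. destruct (C eps P) as [N HN]. exists N. intros n Hn.
  specialize (HN n Hn). unfold Rdist in *. rewrite Rminus_0_r in *.
  pose proof (E n). pose proof (Rle_abs (v n)). lra.
Qed.

Lemma vanish_scal (X : Hilbert) (a : R) (s : nat -> X) :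
  vanish s -> vanish (fun k => hscal a (s k)).
Proof.
  intro V. apply (Un_cv_ext (u := fun k => Rabs a * hnorm (s k))).
  - intro n. rewrite hnorm_scal. reflexivity.
  - rewrite <- (Rmult_0_r (Rabs a)). apply Un_cv_scal, V.
Qed.

Lemma vanish_add (X : Hilbert) (s t : nat -> X) :
  vanish s -> vanish t -> vanish (fun k => hadd (s k) (t k)).
Proof.
  intros V W. apply (@Un_cv_squeeze0 _ (fun k => hnorm (s k) + hnorm (t k))).
  - intro k. rewrite Rabs_pos_eq by apply hnorm_ge0. apply hnorm_add.
  - rewrite <- (Rplus_0_r 0). apply CV_plus; assumption.
Qed.

Lemma vanish_bdd (X : Hilbert) (s : nat -> X) : vanish s -> bdd s.
Proof.
  intro V. destruct (maj_by_pos _ (exist _ 0 V)) as [M [_ HM]].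
  exists M. intro k. specialize (HM k). rewrite Rabs_pos_eq in HM by apply hnorm_ge0. exact HM.
Qed.

Lemma bdd_inner_vanish (X : Hilbert) (s t : nat -> X) :
  bdd s -> vanish t -> Un_cv (fun k => hinner (s k) (t k)) 0.
Proof.
  intros [M HM] V. apply (@Un_cv_squeeze0 _ (fun k => M * hnorm (t k))).
  - intro k. eapply Rle_trans; [apply cauchy_schwarz|].
    apply Rmult_le_compat_r; [apply hnorm_ge0 | apply HM].
  - rewrite <- (Rmult_0_r M). apply Un_cv_scal, V.
Qed.

Lemma vanish_of_sq (X : Hilbert) (s : nat -> X) :
  Un_cv (fun k => hinner (s k) (s k)) 0 -> vanish s.
Proof.
  intros C eps P. destruct (C (eps * eps)) as [N HN]; [nra|].
  exists N. intros n Hn. specialize (HN n Hn). unfold Rdist in *. rewrite Rminus_0_r in *.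
  rewrite Rabs_pos_eq in * by (try apply h_inner_pos; apply hnorm_ge0).
  rewrite <- hnorm_sq in HN. pose proof (hnorm_ge0 (s n)). nra.
Qed.

Lemma bounded_linear_pos (X Y : Hilbert) (B : X -> Y) :
  bounded_linear B -> exists C, 0 <= C /\ forall x, hnorm (B x) <= C * hnorm x.
Proof.
  intros (_ & _ & C & HC). exists (Rabs C). split; [apply Rabs_pos|]. intro x.
  eapply Rle_trans; [apply HC|]. apply Rmult_le_compat_r; [apply hnorm_ge0 | apply Rle_abs].
Qed.

Lemma vanish_cv_inner (X : Hilbert) (s : nat -> X) (l z : X) :
  vanish (fun k => hsub (s k) l) -> Un_cv (fun k => hinner (s k) z) (hinner l z).
Proof.
  intro V. pose proof (bdd_inner_vanish (bdd_const z) V) as C.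
  pose proof (CV_plus _ _ _ _ C (Un_cv_cst (hinner l z))) as D. rewrite Rplus_0_l in D.
  revert D. apply Un_cv_ext. intro n. hexp. hsym. ring.
Qed.

Lemma vanish_strong_cv (X : Hilbert) (s : nat -> X) (l : X) :
  vanish (fun k => hsub (s k) l) <-> strong_cv s l.
Proof.
  unfold vanish, strong_cv, Un_cv, Rdist. split; intros V eps P; destruct (V eps P) as [N HN];
  exists N; intros n Hn; specialize (HN n Hn);
  rewrite Rminus_0_r, (Rabs_pos_eq _ (hnorm_ge0 (hsub (s n) l))) in *; exact HN.
Qed.

(** Completeness in the form that parallelogram estimates deliver: squared distances, and ordered
    indices by symmetry. *)
Lemma complete_sq (X : Hilbert) (s : nat -> X) :
  (forall eps, 0 < eps -> exists N, forall p q, (N <= p)%nat -> (p <= q)%nat ->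
     hinner (hsub (s p) (s q)) (hsub (s p) (s q)) < eps) ->
  exists l, strong_cv s l.
Proof.
  intro C. destruct (h_complete X s) as [l Hl]; [|exists l; exact Hl].
  intros eps P. destruct (C (eps * eps)) as [N HN]; [nra|].
  exists N. intros p q Hp Hq. change (hnorm (hsub (s p) (s q)) < eps).
  assert (K : hinner (hsub (s p) (s q)) (hsub (s p) (s q)) < eps * eps).
  { destruct (Nat.le_ge_cases p q) as [L|L]; [apply HN; lia|].
    assert (E : hinner (hsub (s p) (s q)) (hsub (s p) (s q))
              = hinner (hsub (s q) (s p)) (hsub (s q) (s p))) by (hexp; hsym; ring).
    rewrite E. apply HN; lia. }
  rewrite <- hnorm_sq in K. pose proof (hnorm_ge0 (hsub (s p) (s q))). nra.
Qed.

(** * Weighted products *)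

Lemma wprod_complete (c : R) (Hc : 0 < c) (X Y : Hilbert) (s : nat -> X * Y) :
  let ip (p q : X * Y) := hinner (fst p) (fst q) + c * hinner (snd p) (snd q) in
  let sub (p q : X * Y) := (hadd (fst p) (hopp (fst q)), hadd (snd p) (hopp (snd q))) in
  (forall eps, eps > 0 -> exists N, forall p q, (p >= N)%nat -> (q >= N)%nat ->
     sqrt (ip (sub (s p) (s q)) (sub (s p) (s q))) < eps) ->
  exists l, forall eps, eps > 0 -> exists N, forall n, (n >= N)%nat ->
     sqrt (ip (sub (s n) l) (sub (s n) l)) < eps.
Proof.
  cbv zeta; simpl. intro C.
  assert (Q : forall eps, 0 < eps -> exists N, forall p q, (p >= N)%nat -> (q >= N)%nat ->
    hinner (hsub (fst (s p)) (fst (s q))) (hsub (fst (s p)) (fst (s q))) < eps /\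
    c * hinner (hsub (snd (s p)) (snd (s q))) (hsub (snd (s p)) (snd (s q))) < eps).
  { intros eps P. destruct (C (sqrt eps) (sqrt_lt_R0 _ P)) as [N HN].
    exists N. intros p q Hp Hq. specialize (HN p q Hp Hq). apply sqrt_lt_0_alt in HN.
    pose proof (h_inner_pos _ (hsub (fst (s p)) (fst (s q)))).
    pose proof (h_inner_pos _ (hsub (snd (s p)) (snd (s q)))).
    unfold hsub in *. nra. }
  destruct (@complete_sq X (fun n => fst (s n))) as [l Hl].
  { intros eps P. destruct (Q eps P) as [N HN]. exists N. intros p q Hp Hq.
    apply HN; lia. }
  destruct (@complete_sq Y (fun n => snd (s n))) as [k Hk].
  { intros eps P. destruct (Q (c * eps)) as [N HN]; [nra|]. exists N. intros p q Hp Hq.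
    destruct (HN p q) as [_ K]; [lia|lia|]. nra. }
  exists (l, k). intros eps P. simpl.
  assert (P2 : 0 < eps * eps) by nra.
  destruct (Hl (sqrt (eps * eps / 2))) as [N HN]; [apply sqrt_lt_R0; lra|].
  destruct (Hk (sqrt (eps * eps / (2 * c)))) as [M HM].
  { apply sqrt_lt_R0. apply Rdiv_lt_0_compat; lra. }
  exists (N + M)%nat. intros n Hn.
  specialize (HN n ltac:(lia)). specialize (HM n ltac:(lia)).
  apply sqrt_lt_0_alt in HN. apply sqrt_lt_0_alt in HM.
  rewrite <- (sqrt_square eps) by lra. apply sqrt_lt_1_alt. unfold hsub in *.
  split.
  - apply Rplus_le_le_0_compat; [apply h_inner_pos|].
    apply Rmult_le_pos; [lra | apply h_inner_pos].
  - apply (Rmult_lt_compat_l c) in HM; [|lra].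
    replace (c * (eps * eps / (2 * c))) with (eps * eps / 2) in HM by (field; lra). lra.
Qed.

(** The weight serves two purposes: with [c = gamma / s] the squared norm is the energy that
    decreases along the iteration, and with [c = 1] the spaces [G i] are stacked. *)
Definition wprod (c : R) (Hc : 0 < c) (X Y : Hilbert) : Hilbert.
Proof.
  refine (@Build_Hilbert (X * Y) (hzero, hzero)
    (fun p q => (hadd (fst p) (fst q), hadd (snd p) (snd q)))
    (fun p => (hopp (fst p), hopp (snd p)))
    (fun a p => (hscal a (fst p), hscal a (snd p)))
    (fun p q => hinner (fst p) (fst q) + c * hinner (snd p) (snd q))
    _ _ _ _ _ _ _ _ _ _ _ _ _ (@wprod_complete c Hc X Y));
  simpl; intros; repeat match goal with p : (_ * _)%type |- _ => destruct p end; simpl in *.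
  1-8: f_equal; vec.
  - hsym; ring.
  - hexp; ring.
  - hexp; ring.
  - apply Rplus_le_le_0_compat; [|apply Rmult_le_pos; [lra|]]; apply h_inner_pos.
  - match goal with E : hinner ?a _ + c * hinner ?b _ = 0 |- _ =>
      pose proof (h_inner_pos _ a); pose proof (h_inner_pos _ b);
      f_equal; apply h_inner_def; apply Rle_antisym; try assumption; nra
    end.
Defined.

Definition trivH : Hilbert.
Proof.
  refine (@Build_Hilbert unit tt (fun _ _ => tt) (fun _ => tt) (fun _ _ => tt) (fun _ _ => 0)
    _ _ _ _ _ _ _ _ _ _ _ _ _ _);
  intros; repeat match goal with p : unit |- _ => destruct p end; try reflexivity; try lra.
  exists tt. intros eps P. exists 0%nat. intros. rewrite sqrt_0. exact P.
Defined.

(** * Weak limits without compactness *)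

(* [p] lies in the closed convex hull of every tail of [s], expressed through half-spaces. *)
Definition hullpt {X : Hilbert} (s : nat -> X) (p : X) : Prop :=
  forall (a : X) (c : R) (N : nat),
    (forall n, (N <= n)%nat -> hinner (s n) a <= c) -> hinner p a <= c.

(** The version of [hullpt] for one fixed tail; [hullpt s p] asks for it at every [N]. These sets
    are convex and shrink as [N] grows. *)
Definition tailhull {X : Hilbert} (s : nat -> X) (N : nat) (p : X) : Prop :=
  forall (a : X) (c : R),
    (forall n, (N <= n)%nat -> hinner (s n) a <= c) -> hinner p a <= c.

Lemma inf_exists (S : R -> Prop) (b : R) :
  (exists t, S t) -> (forall t, S t -> b <= t) ->
  exists d, (forall t, S t -> d <= t) /\ (forall e, 0 < e -> exists t, S t /\ t < d + e).
Proof.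
  intros [t0 H0] Hb.
  destruct (completeness (fun r => S (- r))) as [m [U L]].
  - exists (- b). intros r Hr. specialize (Hb _ Hr). lra.
  - exists (- t0). rewrite Ropp_involutive. exact H0.
  - exists (- m). split.
    + intros t Ht. assert (- t <= m) by (apply U; rewrite Ropp_involutive; exact Ht). lra.
    + intros e P. apply NNPP. intro K.
      assert (m <= m - e); [|lra]. apply L. intros r Hr.
      destruct (Rle_lt_dec r (m - e)) as [Q|Q]; [exact Q|].
      exfalso. apply K. exists (- r). split; [exact Hr | lra].
Qed.

Lemma inv_INR_small (eps : R) : 0 < eps -> exists N, forall n, (N <= n)%nat -> / INR (S n) < eps.
Proof.
  intro P. destruct (archimed_cor1 eps P) as [N [HN N0]]. exists N. intros n Hn.
  eapply Rle_lt_trans; [|exact HN]. apply Rinv_le_contravar; [apply lt_0_INR; lia|].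
  apply le_INR. lia.
Qed.

(* The limit of near-minimal-norm points of the nested tail hulls. *)
Lemma hullpt_exists (X : Hilbert) (s : nat -> X) : bdd s -> exists p, hullpt s p.
Proof.
  intros [M HM].
  assert (M0 : 0 <= M) by (pose proof (HM 0%nat); pose proof (hnorm_ge0 (s 0%nat)); lra).
  assert (In : forall N, tailhull s N (s N)) by (intros N a c K; apply K; lia).
  assert (Mono : forall N N' p, (N <= N')%nat -> tailhull s N' p -> tailhull s N p).
  { intros N N' p Le K a c Q. apply K. intros n Hn. apply Q. lia. }
  (* [d N] is the infimum of the squared norm over the hull of the tail from [N]. It is at most
     [M * M] since [s N] lies in that hull, and it increases with [N] because the hulls are
     nested. *)
  assert (Inf : forall N, exists d, d <= M * M /\
     (forall p, tailhull s N p -> d <= hinner p p) /\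
     (forall e, 0 < e -> exists p, tailhull s N p /\ hinner p p < d + e)).
  { intro N.
    destruct (@inf_exists (fun t => exists p, tailhull s N p /\ t = hinner p p) 0) as [d [L A]].
    - exists (hinner (s N) (s N)), (s N). auto.
    - intros t [p [_ ->]]. apply h_inner_pos.
    - exists d. split; [|split].
      + assert (d <= hinner (s N) (s N)) by (apply L; exists (s N); auto).
        rewrite <- hnorm_sq in H. pose proof (HM N). pose proof (hnorm_ge0 (s N)). nra.
      + intros p Hp. apply L. exists p; auto.
      + intros e P. destruct (A e P) as [t [[p [Hp ->]] Lt]]. exists p; auto. }
  apply choice in Inf. destruct Inf as [d Hd].
  assert (dmono : forall N N', (N <= N')%nat -> d N <= d N').
  { intros N N' Le. apply Rnot_lt_le. intro Lt.
    destruct (Hd N') as (_ & _ & A). destruct (A (d N - d N')) as [p [Hp Q]]; [lra|].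
    destruct (Hd N) as (_ & B & _). specialize (B p (Mono _ _ _ Le Hp)). lra. }
  assert (Ps : forall N, exists p, tailhull s N p /\ hinner p p < d N + / INR (S N)).
  { intro N. apply Hd. apply Rinv_0_lt_compat, lt_0_INR. lia. }
  apply choice in Ps. destruct Ps as [p Hp].
  destruct (growing_cv d) as [D HD].
  { intro n. apply dmono. lia. }
  { exists (M * M). intros r [n ->]. apply Hd. }
  assert (dle : forall n, d n <= D) by (apply growing_ineq; [intro n; apply dmono; lia | exact HD]).
  assert (Cau : forall eps, 0 < eps -> exists N, forall i j, (N <= i)%nat -> (i <= j)%nat ->
     hinner (hsub (p i) (p j)) (hsub (p i) (p j)) < eps).
  { intros eps P. destruct (HD (eps / 8)) as [N1 H1]; [lra|].
    destruct (inv_INR_small (eps := eps / 8)) as [N2 H2]; [lra|].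
    exists (N1 + N2)%nat. intros i j Hi Hj.
    destruct (Hp i) as [Ti Qi]. destruct (Hp j) as [Tj Qj].
    pose proof (H2 i ltac:(lia)). pose proof (H2 j ltac:(lia)).
    pose proof (H1 i ltac:(lia)) as K. unfold Rdist in K.
    apply Rabs_def2 in K. pose proof (dle j).
    (* Both points lie in the larger hull, so their midpoint has squared norm at least [d i]. The
       parallelogram law then bounds the squared distance by [2 (d j - d i)] plus twice both
       tolerances, below [6 eps / 8]. *)
    assert (Mid : tailhull s i (hscal (/2) (hadd (p i) (p j)))).
    { intros a c Q. hexp. pose proof (Ti a c Q).
      pose proof (Mono _ _ _ Hj Tj a c Q). lra. }
    destruct (Hd i) as (_ & B & _). specialize (B _ Mid). revert B. hexp. hsym. lra. }
  destruct (complete_sq Cau) as [l Hl]. exists l. intros a c N Q.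
  apply vanish_strong_cv in Hl. pose proof (vanish_cv_inner a Hl) as C.
  (* Were [l] outside the half-space, so would be some [p n] with [n >= N], against its membership
     in the hull of that tail. *)
  apply Rnot_lt_le. intro Lt. destruct (C (hinner l a - c)) as [N1 H1]; [lra|].
  specialize (H1 (N + N1)%nat ltac:(lia)). unfold Rdist in H1. apply Rabs_def2 in H1.
  destruct (Hp (N + N1)%nat) as [T _].
  pose proof (Mono N (N + N1)%nat _ ltac:(lia) T a c Q). lra.
Qed.

(** The tails eventually lie in the slab of width [2 e] around [l]; the half-spaces with normals [a]
    and [hopp a] force the same on [p]. *)
Lemma hullpt_cv (X : Hilbert) (s : nat -> X) (p a : X) (l : R) :
  hullpt s p -> Un_cv (fun n => hinner (s n) a) l -> hinner p a = l.
Proof.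
  intros Hp C.
  assert (Up : hinner p a <= l).
  { apply le_epsilon. intros e P. destruct (C e P) as [N HN].
    apply (Hp _ _ N). intros n Hn. specialize (HN n Hn). unfold Rdist in HN.
    apply Rabs_def2 in HN. lra. }
  assert (Lo : hinner p (hopp a) <= - l).
  { apply le_epsilon. intros e P. destruct (C e P) as [N HN].
    apply (Hp _ _ N). intros n Hn. specialize (HN n Hn). unfold Rdist in HN.
    apply Rabs_def2 in HN. hexp. lra. }
  revert Lo. hexp. lra.
Qed.

(* Opial's lemma, with weak cluster points replaced by points of [hullpt]: if [p] and [p'] are
   such points for two subsequences, then [<s n, p - p'>] converges, so [<p, p - p'>] and
   [<p', p - p'>] both equal its limit. *)
Lemma opial (X : Hilbert) (s : nat -> X) (S : X -> Prop) :
  bdd s ->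
  (forall p, S p -> exists l, Un_cv (fun n => hinner (hsub (s n) p) (hsub (s n) p)) l) ->
  (forall (phi : nat -> nat) p, (forall n, (n <= phi n)%nat) ->
     hullpt (fun n => s (phi n)) p -> S p) ->
  exists p, S p /\ weak_cv s p.
Proof.
  intros Hb Hcv Hcl.
  destruct (hullpt_exists Hb) as [p Hp].
  assert (Sp : S p) by (apply (Hcl (fun n => n)); [lia | exact Hp]).
  exists p. split; [exact Sp|].
  (* A one-sided bound suffices, since it also applies to [hopp z]. If it failed, a subsequence
     would stay in the half-space [<., z> >= <p, z> + e]; a hull point [q] of it would lie there
     too, yet [q = p] by the convergence of both distances. *)
  assert (One : forall z e, 0 < e -> exists N, forall n, (N <= n)%nat ->
     hinner (s n) z < hinner p z + e).
  { intros z e P. apply NNPP. intro K.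
    assert (Sub : forall N, exists n, (N <= n)%nat /\ hinner p z + e <= hinner (s n) z).
    { intro N. apply NNPP. intro K2. apply K. exists N. intros n Hn.
      apply Rnot_le_lt. intro Q. apply K2. exists n. auto. }
    apply choice in Sub. destruct Sub as [phi Hphi].
    destruct (@hullpt_exists X (fun n => s (phi n))) as [q Hq].
    { destruct Hb as [M HM]. exists M. intro k. apply HM. }
    assert (Sq : S q) by (apply (Hcl phi); [intro n; apply Hphi | exact Hq]).
    assert (L1 : hinner q (hopp z) <= - (hinner p z + e)).
    { apply (Hq _ _ 0%nat). intros n _. destruct (Hphi n) as [_ Q]. hexp. lra. }
    destruct (Hcv p Sp) as [lp Cp]. destruct (Hcv q Sq) as [lq Cq].
    assert (C : Un_cv (fun n => hinner (s n) (hsub p q))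
                  (/2 * (lq - lp) + (/2 * (hinner p p - hinner q q)))).
    { pose proof (CV_plus _ _ _ _ (Un_cv_scal (/2) (CV_minus _ _ _ _ Cq Cp))
                   (Un_cv_cst (/2 * (hinner p p - hinner q q)))) as C.
      revert C. apply Un_cv_ext. intro n. hexp. hsym. field. }
    assert (E1 := hullpt_cv Hp C).
    assert (Cphi : Un_cv (fun n => hinner (s (phi n)) (hsub p q))
                  (/2 * (lq - lp) + (/2 * (hinner p p - hinner q q)))).
    { intros eps Pe. destruct (C eps Pe) as [N HN]. exists N. intros n Hn.
      apply HN. destruct (Hphi n). lia. }
    assert (E2 := hullpt_cv Hq Cphi).
    assert (Epq : p = q).
    { apply hsub_eq0. rewrite <- E2 in E1. revert E1. hexp. hsym. lra. }
    subst q. revert L1. hexp. lra. }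
  intros z e P. destruct (One z e P) as [N1 H1]. destruct (One (hopp z) e P) as [N2 H2].
  exists (N1 + N2)%nat. intros n Hn. specialize (H1 n ltac:(lia)). specialize (H2 n ltac:(lia)).
  revert H2. hexp. intro H2. unfold Rdist. apply Rabs_def1; lra.
Qed.

(** * Subgradients and proximal points *)

Lemma ele_eps (a : ERbar) (M : R) : (forall e, 0 < e -> ele a (Fin (M + e))) -> ele a (Fin M).
Proof.
  destruct a as [r|]; simpl; intro K.
  - apply le_epsilon, K.
  - exact (K 1 Rlt_0_1).
Qed.

Lemma ele_Fin_inv (a : ERbar) (M : R) : ele a (Fin M) -> exists r, a = Fin r /\ r <= M.
Proof. destruct a as [r|]; simpl; [exists r; auto | tauto]. Qed.

Lemma subdiff_fin (X : Hilbert) (phi : X -> ERbar) (x u z : X) (a b : R) :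
  subdiff phi x u -> phi x = Fin a -> phi z = Fin b -> a + hinner u (hsub z x) <= b.
Proof.
  intros [a' [E K]] Ea Eb. rewrite Ea in E. injection E as ->.
  specialize (K z). rewrite Eb in K. exact K.
Qed.

Lemma prox_obj_fin (X : Hilbert) (c : R) (phi : X -> ERbar) (u x : X) (a : R) :
  phi x = Fin a -> prox_obj c phi u x = Fin (/2 * hinner (hsub x u) (hsub x u) + c * a).
Proof. intro E. unfold prox_obj. rewrite E, <- hnorm_sq. do 2 f_equal. ring. Qed.

(** The affine minorant at [x0] bounds the objective below, its quadratic part makes minimizing
    sequences Cauchy, and lower semicontinuity makes the limit a minimizer. *)
Lemma prox_point_exists (X : Hilbert) (c : R) (phi : X -> ERbar) (u x0 w0 : X) :
  0 < c -> convex_fun phi -> lsc phi -> subdiff phi x0 w0 ->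
  exists p, forall x, ele (prox_obj c phi u p) (prox_obj c phi u x).
Proof.
  intros Hc Hcvx Hlsc [a0 [E0 S0]].
  set (J := fun x a => /2 * hinner (hsub x u) (hsub x u) + c * a).
  (* The lower bound comes from completing the square in [/2 * |x - u|^2 + c * <w0, x - x0>]. *)
  destruct (@inf_exists (fun t => exists x a, phi x = Fin a /\ t = J x a)
     (c * a0 + c * hinner w0 (hsub u x0) - c * c / 2 * hinner w0 w0)) as [d [Ld Ad]].
  - exists (J x0 a0), x0, a0. auto.
  - intros t (x & a & Ea & ->). specialize (S0 x). rewrite Ea in S0. simpl in S0.
    pose proof (h_inner_pos _ (hadd (hsub x u) (hscal c w0))) as P.
    apply (Rmult_le_compat_l c) in S0; [|lra]. unfold J. revert P S0. hexp. hsym. lra.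
  - assert (Sq : forall n, exists xa, phi (fst xa) = Fin (snd xa) /\
        J (fst xa) (snd xa) < d + / INR (S n)).
    { intro n. destruct (Ad (/ INR (S n))) as (t & (x & a & Ea & ->) & Lt).
      - apply Rinv_0_lt_compat, lt_0_INR. lia.
      - exists (x, a). auto. }
    apply choice in Sq. destruct Sq as [s Hs].
    destruct (@complete_sq X (fun n => fst (s n))) as [p Hp].
    { intros eps P. destruct (inv_INR_small (eps := eps / 8)) as [N HN]; [lra|].
      exists N. intros i j Hi Hj.
      destruct (Hs i) as [Ei Li]. destruct (Hs j) as [Ej Lj].
      pose proof (HN i ltac:(lia)). pose proof (HN j ltac:(lia)).
      (* At the midpoint the objective drops below the average by one eighth of the squared
         distance, yet stays above [d]; hence the tolerance [eps / 8]. *)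
      assert (K := Hcvx _ _ _ _ (/2) ltac:(lra) Ei Ej).
      apply ele_Fin_inv in K. destruct K as (b & Eb & Lb).
      assert (Q : d <= J (hadd (hscal (/2) (fst (s i))) (hscal (1 - /2) (fst (s j)))) b)
        by (apply Ld; eexists; eexists; split; [exact Eb | reflexivity]).
      apply (Rmult_le_compat_l c) in Lb; [|lra].
      revert Q Li Lj. unfold J. hexp. hsym. lra. }
    apply vanish_strong_cv in Hp.
    assert (Cn : Un_cv (fun n => hinner (hsub (fst (s n)) u) (hsub (fst (s n)) u))
                    (hinner (hsub p u) (hsub p u))).
    { pose proof (bdd_inner_vanish (vanish_bdd Hp) Hp) as C1.
      pose proof (bdd_inner_vanish (bdd_const (hsub p u)) Hp) as C2.
      pose proof (CV_plus _ _ _ _ (CV_plus _ _ _ _ C1 (Un_cv_scal 2 C2))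
          (Un_cv_cst (hinner (hsub p u) (hsub p u)))) as C.
      replace (0 + 2 * 0 + hinner (hsub p u) (hsub p u))
        with (hinner (hsub p u) (hsub p u)) in C by ring.
      revert C. apply Un_cv_ext. intro n. hexp. hsym. ring. }
    assert (B : ele (phi p) (Fin ((d - /2 * hinner (hsub p u) (hsub p u)) / c))).
    { apply ele_eps. intros e P.
      destruct (Cn (c * e)) as [N1 H1]; [nra|].
      destruct (inv_INR_small (eps := c * e / 2)) as [N2 H2]; [nra|].
      (* The sequence is shifted because [lsc] asks for the sublevel bound at every index, while it
         holds only from [N1 + N2] on. *)
      apply (Hlsc _ (fun n => fst (s (N1 + N2 + n)%nat))).
      - intro n. destruct (Hs (N1 + N2 + n)%nat) as [E Lt]. rewrite E. simpl.
        specialize (H1 (N1 + N2 + n)%nat ltac:(lia)). specialize (H2 (N1 + N2 + n)%nat ltac:(lia)).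
        unfold Rdist in H1. apply Rabs_def2 in H1. unfold J in Lt.
        apply (Rmult_le_reg_l c); [lra|].
        replace (c * ((d - / 2 * hinner (hsub p u) (hsub p u)) / c + e))
          with (d - / 2 * hinner (hsub p u) (hsub p u) + c * e) by (field; lra). lra.
      - apply vanish_strong_cv in Hp. intros eps Pe. destruct (Hp eps Pe) as [N HN].
        exists N. intros n Hn. apply HN. lia. }
    apply ele_Fin_inv in B. destruct B as (b & Eb & Lb).
    exists p. intro x. rewrite (prox_obj_fin _ _ Eb).
    destruct (phi x) as [a|] eqn:Ea; [rewrite (prox_obj_fin _ _ Ea) | unfold prox_obj; rewrite Ea; exact I].
    simpl. assert (d <= J x a) by (apply Ld; eauto). unfold J in *.
    apply (Rmult_le_compat_l c) in Lb; [|lra].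
    replace (c * ((d - / 2 * hinner (hsub p u) (hsub p u)) / c))
      with (d - / 2 * hinner (hsub p u) (hsub p u)) in Lb by (field; lra). lra.
Qed.

Lemma small_t_limit (A K : R) : (forall t, 0 < t < 1 -> 0 <= A + t * K) -> 0 <= A.
Proof.
  intro Q. apply Rnot_lt_le. intro N.
  set (t := Rmin (/2) (- A / (2 * (Rabs K + 1)))).
  pose proof (Rabs_pos K). pose proof (Rle_abs K).
  assert (P : 0 < - A / (2 * (Rabs K + 1))) by (apply Rdiv_lt_0_compat; lra).
  assert (T0 : 0 < t) by (apply Rmin_glb_lt; lra).
  assert (T1 : t <= / 2) by apply Rmin_l.
  assert (T2 : t <= - A / (2 * (Rabs K + 1))) by apply Rmin_r.
  specialize (Q t ltac:(lra)).
  apply (Rmult_le_compat_r (Rabs K + 1)) in T2; [|lra].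
  replace (- A / (2 * (Rabs K + 1)) * (Rabs K + 1)) with (- A / 2) in T2 by (field; lra).
  nra.
Qed.

(** Fermat's rule: minimality is tested on the segment from [p] to [y], divided by [t], and [t] is
    sent to 0. Only the quadratic term keeps a factor [t]. *)
Lemma prox_point_subdiff (X : Hilbert) (c : R) (phi : X -> ERbar) (u p : X) :
  0 < c -> proper phi -> convex_fun phi ->
  (forall x, ele (prox_obj c phi u p) (prox_obj c phi u x)) ->
  subdiff phi p (hscal (/ c) (hsub u p)).
Proof.
  intros Hc [x0 Hx0] Hcvx Hmin.
  destruct (phi p) as [a|] eqn:Ea.
  2:{ exfalso. specialize (Hmin x0). unfold prox_obj in Hmin. rewrite Ea in Hmin.
      destruct (phi x0); [exact Hmin | congruence]. }
  exists a. split; [exact Ea|]. intro y.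
  destruct (phi y) as [b|] eqn:Eb; [simpl | exact I].
  assert (Q : 0 <= (c * (b - a) + hinner (hsub p u) (hsub y p))).
  { apply (small_t_limit (K := /2 * hinner (hsub y p) (hsub y p))). intros t Ht.
    assert (K := Hcvx _ _ _ _ t Ht Eb Ea). apply ele_Fin_inv in K.
    destruct K as (r & Er & Lr). specialize (Hmin (hadd (hscal t y) (hscal (1 - t) p))).
    rewrite (prox_obj_fin _ _ Ea), (prox_obj_fin _ _ Er) in Hmin. simpl in Hmin.
    apply (Rmult_le_compat_l c) in Lr; [|lra].
    apply (Rmult_le_reg_l t); [lra|]. revert Hmin. hexp. hsym. intro Hmin. nra. }
  apply (Rmult_le_reg_l c); [lra|]. revert Q. hexp. intro Q.
  field_simplify; [|lra]. lra.
Qed.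

Lemma prox_minimizes (X : Hilbert) (c : R) (phi : X -> ERbar) (u : X) :
  (exists p, forall x, ele (prox_obj c phi u p) (prox_obj c phi u x)) ->
  forall x, ele (prox_obj c phi u (prox c phi u)) (prox_obj c phi u x).
Proof. intro E. unfold prox. apply epsilon_spec. exact E. Qed.

Lemma prox_subdiff (X : Hilbert) (c : R) (phi : X -> ERbar) (u x0 w0 : X) :
  0 < c -> Gamma0 phi -> subdiff phi x0 w0 ->
  subdiff phi (prox c phi u) (hscal (/ c) (hsub u (prox c phi u))).
Proof.
  intros Hc (Hp & Hcvx & Hlsc) S0. apply prox_point_subdiff; try assumption.
  apply prox_minimizes. eapply prox_point_exists; eassumption.
Qed.

(** Validates the choice in [fconj]: by properness the set is nonempty, so it either has a least
    upper bound or is unbounded above. *)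
Lemma fconj_sup (X : Hilbert) (phi : X -> ERbar) (y : X) : proper phi ->
  is_esup (fun t => exists x a, phi x = Fin a /\ t = hinner y x - a) (fconj phi y).
Proof.
  intros [x0 Hx0]. unfold fconj. apply epsilon_spec.
  set (S := fun t => exists x a, phi x = Fin a /\ t = hinner y x - a).
  destruct (classic (bound S)) as [Hb|Hb].
  - destruct (completeness S Hb) as [r Hr].
    + destruct (phi x0) as [a|] eqn:E; [|congruence]. exists (hinner y x0 - a), x0, a. auto.
    + exists (Fin r). exact Hr.
  - exists PInf. intro M. apply NNPP. intro K. apply Hb. exists M. intros t Ht.
    apply Rnot_lt_le. intro Lt. apply K. exists t. auto.
Qed.

Lemma fconj_ge (X : Hilbert) (phi : X -> ERbar) (x y : X) (a : R) :
  phi x = Fin a -> ele (Fin (hinner y x - a)) (fconj phi y).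
Proof.
  intro E. assert (P : proper phi) by (exists x; congruence).
  pose proof (fconj_sup y P) as Q. destruct (fconj phi y) as [r|]; [|exact I].
  simpl. apply Q. exists x, a. auto.
Qed.

(** Equality case of Fenchel-Young: the subgradient inequality says that [x] attains the supremum
    defining the conjugate at [y]. *)
Lemma fconj_subdiff (X : Hilbert) (phi : X -> ERbar) (x y : X) (a : R) :
  phi x = Fin a -> subdiff phi x y -> fconj phi y = Fin (hinner y x - a).
Proof.
  intros E S. assert (P : proper phi) by (exists x; congruence).
  assert (Ub : forall z b, phi z = Fin b -> hinner y z - b <= hinner y x - a).
  { intros z b Eb. pose proof (subdiff_fin S E Eb) as K. revert K. hexp. lra. }
  pose proof (fconj_sup y P) as Q. pose proof (fconj_ge y E) as L.
  destruct (fconj phi y) as [r|]; simpl in *.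
  - f_equal. apply Rle_antisym; [|exact L]. apply Q. intros t (z & b & Eb & ->). auto.
  - destruct (Q (hinner y x - a)) as (t & (z & b & Eb & ->) & Lt).
    specialize (Ub z b Eb). lra.
Qed.

(* Moreau decomposition: [q := prox_{phi/s}(a/s)] satisfies [a - s q \in \partial phi(q)], and
   [a - s q] is then the unique minimizer defining [prox_{s phi^*}(a)]. *)
Lemma prox_fconj_subdiff (X : Hilbert) (s : R) (phi : X -> ERbar) (a x0 w0 : X) :
  0 < s -> Gamma0 phi -> subdiff phi x0 w0 ->
  subdiff phi (hscal (/ s) (hsub a (prox s (fconj phi) a))) (prox s (fconj phi) a).
Proof.
  intros Hs HG S0.
  assert (Hs' : 0 < / s) by (apply Rinv_0_lt_compat; lra).
  pose proof (prox_subdiff (hscal (/ s) a) Hs' HG S0) as Sq.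
  set (q := prox (/ s) phi (hscal (/ s) a)) in *.
  set (y := hscal (/ / s) (hsub (hscal (/ s) a) q)) in *.
  assert (Ea : a = hadd y (hscal s q)).
  { unfold y. apply hext. intro z. hexp. field. lra. }
  pose proof Sq as [b [Eb _]].
  pose proof (fconj_subdiff Eb Sq) as Ey.
  (* Fenchel-Young at [q] yields minimality of [y] with a quadratic margin. The margin gives
     uniqueness, which identifies the minimizer picked by [epsilon] with [y]. *)
  assert (Gap : forall t r, fconj phi t = Fin r ->
    /2 * hinner (hsub y a) (hsub y a) + s * (hinner y q - b) + /2 * hinner (hsub t y) (hsub t y)
      <= /2 * hinner (hsub t a) (hsub t a) + s * r).
  { intros t r Er. pose proof (fconj_ge t Eb) as K. rewrite Er in K. simpl in K.
    apply (Rmult_le_compat_l s) in K; [|lra]. rewrite Ea. revert K. hexp. hsym. lra. }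
  assert (My : forall t, ele (prox_obj s (fconj phi) a y) (prox_obj s (fconj phi) a t)).
  { intro t. rewrite (prox_obj_fin _ _ Ey).
    destruct (fconj phi t) as [r|] eqn:Er; [|unfold prox_obj; rewrite Er; exact I].
    rewrite (prox_obj_fin _ _ Er). simpl. pose proof (Gap t r Er).
    pose proof (h_inner_pos _ (hsub t y)). lra. }
  pose proof (prox_minimizes (ex_intro _ y My) y) as Mp.
  assert (Ep : prox s (fconj phi) a = y).
  { set (p := prox s (fconj phi) a) in *.
    rewrite (prox_obj_fin _ _ Ey) in Mp.
    destruct (fconj phi p) as [r|] eqn:Er.
    - rewrite (prox_obj_fin _ _ Er) in Mp. simpl in Mp. pose proof (Gap p r Er).
      pose proof (h_inner_pos _ (hsub p y)). apply hsub_eq0. lra.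
    - unfold prox_obj in Mp. rewrite Er in Mp. contradiction. }
  rewrite Ep. replace (hscal (/ s) (hsub a y)) with q; [exact Sq|].
  rewrite Ea. apply hext. intro z. hexp. field. lra.
Qed.

(* [phi] is the supremum of its exact affine minorants. Unlike [Gamma0], this passes trivially to
   separable sums and is all that the limit argument needs. *)
Definition sup_of_minorants {X : Hilbert} (phi : X -> ERbar) : Prop :=
  forall (x : X) (M : R),
    (forall q w b, subdiff phi q w -> phi q = Fin b -> b + hinner w (hsub x q) <= M) ->
    ele (phi x) (Fin M).

(* The subgradients at [q := prox_{t phi}(x)] for small [t] suffice. *)
Lemma Gamma0_sup_of_minorants (X : Hilbert) (phi : X -> ERbar) (x0 w0 : X) :
  Gamma0 phi -> subdiff phi x0 w0 -> sup_of_minorants phi.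
Proof.
  intros HG S0 x M Hb. pose proof HG as (_ & _ & Hlsc).
  set (t := fun n => / INR (S n)).
  assert (Tp : forall n, 0 < t n) by (intro n; apply Rinv_0_lt_compat, lt_0_INR; lia).
  set (q := fun n => prox (t n) phi x).
  assert (Sq : forall n, subdiff phi (q n) (hscal (/ t n) (hsub x (q n))))
    by (intro n; eapply prox_subdiff; eauto).
  pose proof S0 as [a0 [E0 K0]].
  set (C := 1 + Rabs (M - a0 - hinner w0 (hsub x x0)) + hinner w0 w0).
  (* The minorant at [q n], evaluated at [x], gives [phi (q n) + |q n - x|^2 / t n <= M]. The
     minorant at [x0] bounds [phi (q n)] below, and [C] collects the constants left after completing
     the square. So [q n] tends to [x] inside the sublevel set of [M]. *)
  assert (Est : forall n, ele (phi (q n)) (Fin M) /\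
     hinner (hsub (q n) x) (hsub (q n) x) <= 2 * C * t n).
  { intro n. pose proof (Sq n) as [b [Eb _]].
    pose proof (Hb _ _ _ (Sq n) Eb) as U. pose proof (subdiff_fin S0 E0 Eb) as Lo.
    pose proof (h_inner_pos _ (hsub (q n) x)) as P.
    assert (Tn : t n <= 1).
    { unfold t. rewrite <- Rinv_1. apply Rinv_le_contravar; [lra|].
      rewrite S_INR. pose proof (pos_INR n). lra. }
    assert (U' : b + / t n * hinner (hsub (q n) x) (hsub (q n) x) <= M).
    { revert U. hexp. hsym. lra. }
    assert (P' : 0 <= / t n * hinner (hsub (q n) x) (hsub (q n) x)).
    { apply Rmult_le_pos; [left; apply Rinv_0_lt_compat, Tp | exact P]. }
    split; [rewrite Eb; simpl; lra|].
    apply (Rmult_le_compat_l (t n)) in U'; [|left; apply Tp].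
    replace (t n * (b + / t n * hinner (hsub (q n) x) (hsub (q n) x)))
      with (t n * b + hinner (hsub (q n) x) (hsub (q n) x)) in U'
      by (field; pose proof (Tp n); lra).
    pose proof (Rle_abs (M - a0 - hinner w0 (hsub x x0))) as Ab.
    pose proof (h_inner_pos _ (hadd (hsub (q n) x) (hscal (t n) w0))) as Y.
    pose proof (h_inner_pos _ w0). pose proof (Tp n).
    assert (Lo' : t n * (M - b) <= t n * (C - 1 - hinner w0 w0 - hinner w0 (hsub (q n) x))).
    { apply Rmult_le_compat_l; [lra|]. unfold C. revert Lo Ab. hexp. lra. }
    assert (W : 0 <= t n * hinner w0 w0) by (apply Rmult_le_pos; lra).
    pose proof (Rmult_le_compat_r _ _ _ W Tn) as W'.
    revert Y Lo' U' P. generalize (hsub (q n) x). intros d. hexp. hsym. lra. }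
  apply (Hlsc _ q); [intro n; apply Est|].
  apply vanish_strong_cv, vanish_of_sq.
  assert (C0 : 0 <= C).
  { unfold C. pose proof (Rabs_pos (M - a0 - hinner w0 (hsub x x0))).
    pose proof (h_inner_pos _ w0). lra. }
  apply (@Un_cv_squeeze0 _ (fun n => 2 * C * t n)).
  - intro n. rewrite Rabs_pos_eq by apply h_inner_pos. apply Est.
  - rewrite <- (Rmult_0_r (2 * C)). apply Un_cv_scal. intros e P.
    destruct (inv_INR_small P) as [N HN]. exists N. intros n Hn.
    unfold Rdist. rewrite Rminus_0_r, Rabs_pos_eq by (left; apply Tp). apply HN. lia.
Qed.

(** * Convex functions with Lipschitz gradient *)

Lemma grad_dir (X : Hilbert) (f : X -> R) (df : X -> X) (x d : X) (e : R) :
  is_gradient f df -> 0 < e -> exists delta, 0 < delta /\ forall t, Rabs t < delta ->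
    Rabs (f (hadd x (hscal t d)) - f x - t * hinner (df x) d) <= e * Rabs t.
Proof.
  intros Hg P. pose proof (hnorm_ge0 d) as N.
  (* The added 1 keeps the quotient meaningful when [d] is zero. *)
  destruct (Hg x (e / (hnorm d + 1))) as (delta & Pd & K); [apply Rdiv_lt_0_compat; lra|].
  exists (delta / (hnorm d + 1)). split; [apply Rdiv_lt_0_compat; lra|]. intros t Ht.
  pose proof (Rabs_pos t).
  apply (Rmult_lt_compat_r (hnorm d + 1)) in Ht; [|lra].
  replace (delta / (hnorm d + 1) * (hnorm d + 1)) with delta in Ht by (field; lra).
  specialize (K (hscal t d)). rewrite hnorm_scal, inner_scalr in K.
  eapply Rle_trans; [apply K; nra|].
  replace (e * Rabs t) with (e / (hnorm d + 1) * (Rabs t * (hnorm d + 1))) by (field; lra).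
  apply Rmult_le_compat_l; [left; apply Rdiv_lt_0_compat; lra|]. nra.
Qed.

Lemma dir_deriv_le (X : Hilbert) (f : X -> R) (df : X -> X) (x d : X) (A : R) :
  is_gradient f df ->
  (forall t, 0 < t < 1 -> f (hadd x (hscal t d)) - f x <= t * A) -> hinner (df x) d <= A.
Proof.
  intros Hg K. apply le_epsilon. intros e P.
  destruct (grad_dir x d Hg P) as (delta & Pd & Q).
  set (t := Rmin (delta / 2) (/ 2)).
  assert (0 < t) by (apply Rmin_glb_lt; lra).
  assert (t <= delta / 2) by apply Rmin_l. assert (t <= /2) by apply Rmin_r.
  specialize (Q t). rewrite (Rabs_pos_eq t) in Q by lra. specialize (Q ltac:(lra)).
  specialize (K t ltac:(lra)).
  pose proof (Rle_abs (- (f (hadd x (hscal t d)) - f x - t * hinner (df x) d))) as Ab.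
  rewrite Rabs_Ropp in Ab.
  apply (Rmult_le_reg_l t); [lra|]. lra.
Qed.

Lemma dir_deriv_ge (X : Hilbert) (f : X -> R) (df : X -> X) (x d : X) (A : R) :
  is_gradient f df ->
  (forall t, 0 < t < 1 -> t * A <= f (hadd x (hscal t d)) - f x) -> A <= hinner (df x) d.
Proof.
  intros Hg K.
  assert (Hg' : is_gradient (fun z => - f z) (fun z => hopp (df z))).
  { intros z e P. destruct (Hg z e P) as (delta & Pd & Q). exists delta. split; [exact Pd|].
    intros k Hk. rewrite inner_oppl, <- Rabs_Ropp.
    replace (- (- f (hadd z k) - - f z - - hinner (df z) k))
      with (f (hadd z k) - f z - hinner (df z) k) by ring. apply Q, Hk. }
  assert (Q := @dir_deriv_le _ _ _ x d (- A) Hg'). cbv beta in Q. rewrite inner_oppl in Q.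
  assert (- hinner (df x) d <= - A); [|lra]. apply Q. intros t Ht. specialize (K t Ht). lra.
Qed.

Lemma gradient_ineq (X : Hilbert) (f : X -> R) (df : X -> X) (x z : X) :
  (forall x y t, 0 < t < 1 ->
      f (hadd (hscal t x) (hscal (1 - t) y)) <= t * f x + (1 - t) * f y) ->
  is_gradient f df -> f x + hinner (df x) (hsub z x) <= f z.
Proof.
  intros Hc Hg.
  assert (hinner (df x) (hsub z x) <= f z - f x); [|lra].
  apply (dir_deriv_le Hg). intros t Ht. specialize (Hc z x t Ht).
  replace (hadd x (hscal t (hsub z x))) with (hadd (hscal t z) (hscal (1 - t) x)) by vec. lra.
Qed.

(** [F] is the deviation of [f] along the segment from its quadratic model. The Lipschitz bound
    gives [F' <= 0] on the open interval, so [F 1 <= F 0] by the mean value theorem. *)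
Lemma descent_lemma (X : Hilbert) (f : X -> R) (df : X -> X) (L : R) (x d : X) :
  0 < L -> is_gradient f df -> lipschitz L df ->
  f (hadd x d) <= f x + hinner (df x) d + L / 2 * hinner d d.
Proof.
  intros HL Hg Hl.
  set (F := fun t => f (hadd x (hscal t d)) - t * hinner (df x) d - L / 2 * hinner d d * (t * t)).
  set (F' := fun t => hinner (df (hadd x (hscal t d))) d - hinner (df x) d
                      - L / 2 * hinner d d * (2 * t)).
  destruct (MVT_cor2 F F' 0 1 Rlt_0_1) as (c & Ec & Hc).
  (* Half of [e] pays for the first-order error of [f], the other half for the quadratic term
     [K * t^2]. *)
  { intros c _ e P.
    pose proof (h_inner_pos _ d) as D.
    set (K := L / 2 * hinner d d). assert (K0 : 0 <= K) by (unfold K; nra).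
    destruct (grad_dir (hadd x (hscal c d)) d Hg (e := e / 2)) as (delta & Pd & Q); [lra|].
    assert (Pm : 0 < Rmin delta (e / (2 * (K + 1)))).
    { apply Rmin_glb_lt; [lra|]. apply Rdiv_lt_0_compat; lra. }
    exists (mkposreal _ Pm). simpl. intros t Ht Lt.
    assert (L1 : Rabs t < delta) by (eapply Rlt_le_trans; [exact Lt | apply Rmin_l]).
    assert (L2 : Rabs t < e / (2 * (K + 1))) by (eapply Rlt_le_trans; [exact Lt | apply Rmin_r]).
    specialize (Q t L1). pose proof (Rabs_pos_lt t Ht) as Tp.
    set (q := f (hadd (hadd x (hscal c d)) (hscal t d)) - f (hadd x (hscal c d))
              - t * hinner (df (hadd x (hscal c d))) d) in *.
    assert (Eq : (F (c + t) - F c) / t - F' c = (q - K * (t * t)) / t).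
    { unfold F, F', q, K.
      replace (hadd x (hscal (c + t) d)) with (hadd (hadd x (hscal c d)) (hscal t d)) by vec.
      field. exact Ht. }
    rewrite Eq. unfold Rdiv. rewrite Rabs_mult, Rabs_inv.
    apply (Rmult_lt_reg_r (Rabs t)); [exact Tp|].
    rewrite Rmult_assoc, Rinv_l, Rmult_1_r by lra.
    apply (Rmult_lt_compat_r (K + 1)) in L2; [|lra].
    replace (e / (2 * (K + 1)) * (K + 1)) with (e / 2) in L2 by (field; lra).
    assert (Rabs (q - K * (t * t)) <= Rabs q + K * (Rabs t * Rabs t)).
    { eapply Rle_trans; [apply Rabs_triang|]. rewrite Rabs_Ropp, !Rabs_mult, (Rabs_pos_eq K K0). lra. }
    nra. }
  assert (Neg : F' c <= 0).
  { unfold F'.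
    pose proof (hinner_le (hsub (df (hadd x (hscal c d))) (df x)) d) as CS.
    pose proof (Hl (hadd x (hscal c d)) x) as HLp.
    replace (hsub (hadd x (hscal c d)) x) with (hscal c d) in HLp by vec.
    rewrite hnorm_scal, (Rabs_pos_eq c) in HLp by lra.
    pose proof (hnorm_ge0 d). pose proof (hnorm_sq d).
    apply (Rmult_le_compat_r (hnorm d)) in HLp; [|assumption].
    replace (L * (c * hnorm d) * hnorm d) with (L * c * hinner d d) in HLp by (rewrite <- H0; ring).
    revert CS. hexp. revert HLp. unfold hsub. lra. }
  revert Ec. unfold F.
  replace (hadd x (hscal 1 d)) with (hadd x d) by vec.
  replace (hadd x (hscal 0 d)) with x by vec. lra.
Qed.

(** Cocoercivity of the gradient: [Half] sharpens the gradient inequality by a quadratic term, and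
    adding its two instances with [x] and [y] exchanged cancels the function values. *)
Lemma baillon_haddad (X : Hilbert) (f : X -> R) (df : X -> X) (L : R) (x y : X) :
  0 < L ->
  (forall x y t, 0 < t < 1 ->
      f (hadd (hscal t x) (hscal (1 - t) y)) <= t * f x + (1 - t) * f y) ->
  is_gradient f df -> lipschitz L df ->
  hinner (hsub (df x) (df y)) (hsub (df x) (df y)) <= L * hinner (hsub (df x) (df y)) (hsub x y).
Proof.
  intros HL Hc Hg Hl.
  (* minimize [f - <df x, .>], which is minimal at [x], along a gradient step from [y] *)
  assert (Half : forall x y, f x + hinner (df x) (hsub y x)
     + / (2 * L) * hinner (hsub (df y) (df x)) (hsub (df y) (df x)) <= f y).
  { intros a b. set (d := hscal (- / L) (hsub (df b) (df a))).
    pose proof (gradient_ineq a (hadd b d) Hc Hg) as G1.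
    pose proof (descent_lemma b d HL Hg Hl) as D1.
    assert (E1 : hinner (hsub (df b) (df a)) d
       = - (/ L * hinner (hsub (df b) (df a)) (hsub (df b) (df a)))) by (unfold d; hexp; ring).
    assert (E2 : L / 2 * hinner d d
       = / (2 * L) * hinner (hsub (df b) (df a)) (hsub (df b) (df a)))
      by (unfold d; hexp; field; lra).
    assert (E3 : / L * hinner (hsub (df b) (df a)) (hsub (df b) (df a))
       = 2 * (/ (2 * L) * hinner (hsub (df b) (df a)) (hsub (df b) (df a)))) by (field; lra).
    assert (E4 : hinner (df a) (hsub (hadd b d) a)
       = hinner (df a) (hsub b a) + hinner (df a) d) by (hexp; ring).
    assert (E5 : hinner (hsub (df b) (df a)) d = hinner (df b) d - hinner (df a) d)
      by (hexp; ring).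
    lra. }
  pose proof (Half x y) as H1. pose proof (Half y x) as H2.
  set (Q := hinner (hsub (df x) (df y)) (hsub (df x) (df y))).
  assert (EQ : hinner (hsub (df y) (df x)) (hsub (df y) (df x)) = Q)
    by (unfold Q; hexp; hsym; ring).
  fold Q in H2. rewrite EQ in H1.
  assert (K : / L * Q <= hinner (hsub (df x) (df y)) (hsub x y)).
  { replace (/ L * Q) with (/ (2 * L) * Q + / (2 * L) * Q) by (field; lra).
    revert H1 H2. generalize (/ (2 * L) * Q). intro r. hexp. lra. }
  apply (Rmult_le_compat_l L) in K; [|lra].
  replace (L * (/ L * Q)) with Q in K by (field; lra). exact K.
Qed.

(** * The iteration with a single operator *)

Record splitting (X Y : Hilbert) (f : X -> R) (df : X -> X) (L : R) (g : X -> ERbar)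
    (h : Y -> ERbar) (B : X -> Y) (Bs : Y -> X) : Prop := {
  sp_L : 0 < L;
  sp_conv : forall x y t, 0 < t < 1 ->
      f (hadd (hscal t x) (hscal (1 - t) y)) <= t * f x + (1 - t) * f y;
  sp_grad : is_gradient f df;
  sp_lip : lipschitz L df;
  sp_gconv : convex_fun g;
  sp_gsup : sup_of_minorants g;
  sp_hsup : sup_of_minorants h;
  sp_adj : is_adjoint B Bs
}.

Definition saddle {X Y : Hilbert} (df : X -> X) (g : X -> ERbar) (h : Y -> ERbar)
    (B : X -> Y) (Bs : Y -> X) (xs : X) (ys : Y) : Prop :=
  subdiff g xs (hopp (hadd (df xs) (Bs ys))) /\ subdiff h (B xs) ys.

Definition fb_arg {X Y : Hilbert} (gamma : R) (df : X -> X) (Bs : Y -> X) (x : X) (y : Y) : X :=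
  hsub (hsub x (hscal gamma (df x))) (hscal gamma (Bs y)).

(* The point at which the new dual iterate [y'] is a subgradient of [h], by Moreau. *)
Definition dual_pt {X Y : Hilbert} (s : R) (B : X -> Y) (v : X) (y y' : Y) : Y :=
  hscal (/ s) (hsub (hadd y (hscal s (B v))) y').

Record pd_step {X Y : Hilbert} (df : X -> X) (g : X -> ERbar) (h : Y -> ERbar)
    (B : X -> Y) (Bs : Y -> X) (gamma s : R) (x v x' : X) (y y' : Y) : Prop := {
  st_v : subdiff g v (hscal (/ gamma) (hsub (fb_arg gamma df Bs x y) v));
  st_y : subdiff h (dual_pt s B v y y') y';
  st_x : subdiff g x' (hscal (/ gamma) (hsub (fb_arg gamma df Bs x y') x'))
}.

Lemma adjoint_swap (X Y : Hilbert) (B : X -> Y) (Bs : Y -> X) :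
  is_adjoint B Bs -> forall y x, hinner y (B x) = hinner (Bs y) x.
Proof. intros A y x. rewrite h_innerC, (A x y). apply h_innerC. Qed.

Lemma adjoint_sub (X Y : Hilbert) (B : X -> Y) (Bs : Y -> X) (x z : X) :
  is_adjoint B Bs -> B (hsub x z) = hsub (B x) (B z).
Proof. intro A. apply hext. intro y. hexp. rewrite !A. hexp. ring. Qed.

Lemma saddle_minimizes (X Y : Hilbert) (f : X -> R) (df : X -> X) (L : R) (g : X -> ERbar)
    (h : Y -> ERbar) (B : X -> Y) (Bs : Y -> X) (xs : X) (ys : Y) :
  splitting f df L g h B Bs -> saddle df g h B Bs xs ys ->
  forall z, ele (eadd (Fin (f xs)) (eadd (g xs) (h (B xs))))
                (eadd (Fin (f z)) (eadd (g z) (h (B z)))).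
Proof.
  intros SP [Sg Sh] z.
  pose proof Sg as [a [Ea _]]. pose proof Sh as [c [Ec _]]. rewrite Ea, Ec.
  destruct (g z) as [b|] eqn:Eb; [|exact I]. destruct (h (B z)) as [e|] eqn:Ee; [simpl|exact I].
  pose proof (subdiff_fin Sg Ea Eb) as I1. pose proof (subdiff_fin Sh Ec Ee) as I2.
  pose proof (gradient_ineq xs z (sp_conv SP) (sp_grad SP)) as I3.
  pose proof (sp_adj SP) as A.
  revert I1 I2 I3. hexp. rewrite !(adjoint_swap A). lra.
Qed.

(** The two minorants vary independently: fixing that of [psi] and taking the supremum over those of
    [phi] bounds [phi x], then the roles are exchanged. The subgradient [w1] starts this by showing
    that [phi x] is finite. *)
Lemma sup_of_minorants_add (X Y : Hilbert) (phi : X -> ERbar) (psi : Y -> ERbar)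
    (x : X) (y : Y) (M : R) (q1 w1 : Y) :
  sup_of_minorants phi -> sup_of_minorants psi -> subdiff psi q1 w1 ->
  (forall q w b q' w' b', subdiff phi q w -> phi q = Fin b -> subdiff psi q' w' ->
     psi q' = Fin b' -> (b + hinner w (hsub x q)) + (b' + hinner w' (hsub y q')) <= M) ->
  ele (eadd (phi x) (psi y)) (Fin M).
Proof.
  intros H1 H2 S1 K.
  assert (A : forall q' w' b', subdiff psi q' w' -> psi q' = Fin b' ->
    ele (phi x) (Fin (M - (b' + hinner w' (hsub y q'))))).
  { intros q' w' b' S E. apply H1. intros q w b Sq Eq. specialize (K _ _ _ _ _ _ Sq Eq S E). lra. }
  pose proof S1 as [c1 [E1 _]].
  pose proof (A _ _ _ S1 E1) as F. apply ele_Fin_inv in F. destruct F as (a & Ea & _).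
  assert (F : ele (psi y) (Fin (M - a))).
  { apply H2. intros q w b S E. specialize (A _ _ _ S E). rewrite Ea in A. simpl in A. lra. }
  apply ele_Fin_inv in F. destruct F as (c & Ec & Lc). rewrite Ea, Ec. simpl. lra.
Qed.

(** After taking suprema over the minorants, the hypothesis says that [(xs, B xs)] minimizes the
    Lagrangian [f z + g z + h r + <ys, B z - r>] over [(z, r)]. Before that it is affine in
    [(xs, ys)], so it can pass to hull points. *)
Lemma saddle_of_gap (X Y : Hilbert) (f : X -> R) (df : X -> X) (L : R) (g : X -> ERbar)
    (h : Y -> ERbar) (B : X -> Y) (Bs : Y -> X) (xs xh : X) (ys yh : Y) :
  splitting f df L g h B Bs -> saddle df g h B Bs xh yh ->
  (forall a z0 u0 b0 q0 w0 c0 z b r c,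
     subdiff g z0 u0 -> g z0 = Fin b0 -> subdiff h q0 w0 -> h q0 = Fin c0 ->
     g z = Fin b -> h r = Fin c ->
     f a + hinner (df a) (hsub xs a) + (b0 + hinner u0 (hsub xs z0))
       + (c0 + hinner w0 (hsub (B xs) q0)) + hinner ys (hsub r (B z)) <= f z + b + c) ->
  saddle df g h B Bs xs ys.
Proof.
  intros SP [Sg Sh] Gap. pose proof (sp_adj SP) as A.
  assert (K : forall z b r c, g z = Fin b -> h r = Fin c ->
    ele (eadd (g xs) (h (B xs))) (Fin (f z + b + c - f xs - hinner ys (hsub r (B z))))).
  { intros z b r c Eb Ec. apply (sup_of_minorants_add (sp_gsup SP) (sp_hsup SP) Sh).
    intros q w b0 q' w' b' S1 E1 S2 E2.
    pose proof (Gap xs _ _ _ _ _ _ _ _ _ _ S1 E1 S2 E2 Eb Ec) as Q.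
    assert (Z : hinner (df xs) (hsub xs xs) = 0) by (hexp; ring). lra. }
  (* Comparing with the known saddle point shows that [g xs] and [h (B xs)] are finite. *)
  pose proof Sg as [bh [Ebh _]]. pose proof Sh as [ch [Ech _]].
  pose proof (K _ _ _ _ Ebh Ech) as F.
  destruct (g xs) as [bs|] eqn:Ebs; [|contradiction].
  destruct (h (B xs)) as [cs|] eqn:Ecs; [|contradiction]. clear F. simpl in K.
  split.
  - exists bs. split; [exact Ebs|]. intro z. destruct (g z) as [b|] eqn:Eb; [simpl|exact I].
    (* With [r = B xs] and [z] moved towards [xs] along a segment, convexity of [g] leaves a
       difference quotient of [f], whose limit is the gradient term. *)
    assert (D : bs - b - hinner (Bs ys) (hsub z xs) <= hinner (df xs) (hsub z xs)).
    { apply (dir_deriv_ge (sp_grad SP)). intros t Ht.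
      assert (Q := sp_gconv SP Ht Eb Ebs). apply ele_Fin_inv in Q. destruct Q as (e & Ee & Le).
      replace (hadd xs (hscal t (hsub z xs))) with (hadd (hscal t z) (hscal (1 - t) xs)) by vec.
      specialize (K _ _ _ _ Ee Ecs). revert K. hexp. rewrite !(adjoint_swap A). hexp. lra. }
    revert D. hexp. lra.
  - exists cs. split; [exact Ecs|]. intro r. destruct (h r) as [c|] eqn:Ec; [simpl|exact I].
    specialize (K _ _ _ _ Ebs Ec). lra.
Qed.

(* The prox inequality at [v] is tested at [x'], the one at [x'] at [xs], and the optimality of
   [xs] at [v], so that the function values of [g] cancel. *)
Lemma fejer_step (X Y : Hilbert) (f : X -> R) (df : X -> X) (L : R) (g : X -> ERbar)
    (h : Y -> ERbar) (B : X -> Y) (Bs : Y -> X) (gamma s beta tau : R)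
    (x v x' xs : X) (y y' ys : Y) :
  splitting f df L g h B Bs -> saddle df g h B Bs xs ys ->
  0 < gamma -> 0 < s -> 0 < tau ->
  (forall z, hinner (B z) (B z) <= beta * hinner z z) ->
  pd_step df g h B Bs gamma s x v x' y y' ->
  hinner (hsub x' xs) (hsub x' xs) + gamma / s * hinner (hsub y' ys) (hsub y' ys)
   + (1 - gamma * L / 2) * hinner (hsub x v) (hsub x v)
   + (1 - tau * beta) * hinner (hsub v x') (hsub v x')
   + (gamma / s - gamma * gamma / tau) * hinner (hsub y' y) (hsub y' y)
  <= hinner (hsub x xs) (hsub x xs) + gamma / s * hinner (hsub y ys) (hsub y ys).
Proof.
  intros SP [Sg Sh] Hg Hs Ht HB [Sv Sy Sx]. pose proof (sp_adj SP) as A.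
  assert (J1 : hinner (hsub (fb_arg gamma df Bs x y) v) (hsub x' v)
     + hinner (hsub (fb_arg gamma df Bs x y') x') (hsub xs x')
     - gamma * hinner (hadd (df xs) (Bs ys)) (hsub v xs) <= 0).
  { pose proof Sv as [bv [Ev _]]. pose proof Sx as [bx [Ex _]]. pose proof Sg as [bs [Es _]].
    pose proof (subdiff_fin Sv Ev Ex) as I1. pose proof (subdiff_fin Sx Ex Es) as I2.
    pose proof (subdiff_fin Sg Es Ev) as I3.
    rewrite h_innerZ in I1, I2. rewrite inner_oppl in I3.
    assert (J : / gamma * hinner (hsub (fb_arg gamma df Bs x y) v) (hsub x' v)
      + / gamma * hinner (hsub (fb_arg gamma df Bs x y') x') (hsub xs x')
      - hinner (hadd (df xs) (Bs ys)) (hsub v xs) <= 0) by lra.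
    apply (Rmult_le_compat_l gamma) in J; [|lra].
    match type of J with ?l <= _ => match goal with |- ?r <= _ =>
      replace r with l by (field; lra) end end. lra. }
  assert (J2 : hinner (hsub y' ys) (hsub (B xs) (B v))
     + / s * hinner (hsub y' ys) (hsub y' y) <= 0).
  { pose proof Sy as [cq [Eq _]]. pose proof Sh as [cs [Es _]].
    pose proof (subdiff_fin Sy Eq Es) as I1. pose proof (subdiff_fin Sh Es Eq) as I2.
    (* In this form, monotonicity of the subdifferential of [h] between this point and [B xs]
       separates the coupling with [B v] from the dual increment. *)
    assert (EQ : dual_pt s B v y y' = hadd (B v) (hscal (/ s) (hsub y y'))).
    { apply hext. intro z. unfold dual_pt. hexp. field. lra. }
    rewrite EQ in I1, I2. revert I1 I2. hexp. hsym. lra. }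
  assert (J3 : - 2 * gamma * hinner (hsub (df x) (df xs)) (hsub v xs)
     <= gamma * L / 2 * hinner (hsub x v) (hsub x v)).
  { pose proof (sp_L SP) as HL.
    pose proof (baillon_haddad x xs HL (sp_conv SP) (sp_grad SP) (sp_lip SP)) as BH.
    (* The weight [L / 2] lets cocoercivity absorb the squared gradient difference, leaving only a
       multiple of [|x - v|^2]; this is where [gamma * L / 2] comes from. *)
    pose proof (h_inner_pos _ (hadd (hsub (df x) (df xs)) (hscal (L / 2) (hsub v x)))) as P.
    assert (Q : 0 <= L * hinner (hsub (df x) (df xs)) (hsub v xs)
                     + L / 2 * (L / 2) * hinner (hsub x v) (hsub x v)).
    { revert BH P. generalize (hsub (df x) (df xs)). intro d. hexp. hsym. lra. }
    assert (Q2 : 0 <= hinner (hsub (df x) (df xs)) (hsub v xs)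
                     + L / 4 * hinner (hsub x v) (hsub x v)).
    { apply (Rmult_le_reg_l L); [lra|].
      replace (L * (hinner (hsub (df x) (df xs)) (hsub v xs) + L / 4 * hinner (hsub x v) (hsub x v)))
        with (L * hinner (hsub (df x) (df xs)) (hsub v xs)
              + L / 2 * (L / 2) * hinner (hsub x v) (hsub x v)) by field. lra. }
    apply (Rmult_le_compat_l (2 * gamma)) in Q2; [|lra]. lra. }
  assert (J4 : 2 * gamma * hinner (hsub y' y) (B (hsub v x'))
     <= tau * beta * hinner (hsub v x') (hsub v x')
        + gamma * gamma / tau * hinner (hsub y' y) (hsub y' y)).
  { pose proof (h_inner_pos _ (hadd (hscal tau (B (hsub v x'))) (hscal (- gamma) (hsub y' y)))) as P.
    specialize (HB (hsub v x')).
    apply (Rmult_le_compat_l (tau * tau)) in HB; [|nra].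
    assert (Q : 2 * gamma * hinner (hsub y' y) (B (hsub v x')) * tau
      <= tau * tau * (beta * hinner (hsub v x') (hsub v x'))
         + gamma * gamma * hinner (hsub y' y) (hsub y' y)).
    { revert P HB. generalize (B (hsub v x')), (hsub y' y). intros d e.
      generalize (hsub v x'). intro d'. hexp. hsym. lra. }
    apply (Rmult_le_reg_r tau); [lra|].
    match type of Q with _ <= ?l => match goal with |- _ <= ?r =>
      replace r with l by (field; lra) end end. exact Q. }
  rewrite (adjoint_sub v x' A) in J4.
  apply (Rmult_le_compat_l (2 * gamma)) in J2; [|lra].
  replace (gamma / s) with (gamma * / s) by reflexivity.
  revert J1 J2 J3 J4. unfold fb_arg. generalize (gamma * gamma / tau), (/ s). intros r1 r2.
  hexp. rewrite !(adjoint_swap A). hsym. lra.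
Qed.

(** The inequality of [saddle_of_gap] at an iterate, obtained by adding six subgradient and gradient
    inequalities. Every error term contains one of [x - v], [B x - q], [q - B v], [y' - y], all of
    which vanish along the iteration. *)
Lemma gap_step (X Y : Hilbert) (f : X -> R) (df : X -> X) (L : R) (g : X -> ERbar)
    (h : Y -> ERbar) (B : X -> Y) (Bs : Y -> X) (gamma s : R) (x v x' : X) (y y' : Y)
    (a z0 u0 : X) (b0 : R) (q0 w0 : Y) (c0 : R) (z : X) (b : R) (r : Y) (c : R) :
  splitting f df L g h B Bs -> 0 < gamma ->
  pd_step df g h B Bs gamma s x v x' y y' ->
  subdiff g z0 u0 -> g z0 = Fin b0 -> subdiff h q0 w0 -> h q0 = Fin c0 ->
  g z = Fin b -> h r = Fin c ->
  let q := dual_pt s B v y y' in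
  f a + hinner (df a) (hsub x a) + (b0 + hinner u0 (hsub x z0))
    + (c0 + hinner w0 (hsub (B x) q0)) + hinner y (hsub r (B z)) <= f z + b + c
  + (hinner u0 (hsub x v) + hinner w0 (hsub (B x) q) + hinner (df x) (hsub x v)
     + / gamma * hinner (hsub v z) (hsub x v) + hinner y (hsub q (B v))
     + hinner (hsub q r) (hsub y' y)).
Proof.
  intros SP Hg [Sv Sy _] S0 E0 T0 F0 Eb Ec q. fold q in Sy. pose proof (sp_adj SP) as A.
  pose proof Sv as [bv [Ev _]]. pose proof Sy as [cq [Eq _]].
  pose proof (subdiff_fin Sv Ev Eb) as I1. pose proof (subdiff_fin S0 E0 Ev) as I2.
  pose proof (subdiff_fin Sy Eq Ec) as I3. pose proof (subdiff_fin T0 F0 Eq) as I4.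
  pose proof (gradient_ineq x z (sp_conv SP) (sp_grad SP)) as I5.
  pose proof (gradient_ineq a x (sp_conv SP) (sp_grad SP)) as I6.
  assert (E : hscal (/ gamma) (hsub (fb_arg gamma df Bs x y) v)
     = hsub (hsub (hscal (/ gamma) (hsub x v)) (df x)) (Bs y)).
  { apply hext. intro e. unfold fb_arg. hexp. field. lra. }
  rewrite E in I1. revert I1 I2 I3 I4 I5 I6. generalize q. intro q1.
  hexp. rewrite !(adjoint_swap A). hsym. lra.
Qed.

(** * Vanishing residuals and weak convergence of the iterates *)

Lemma hullpt_limit_le (X : Hilbert) (s : nat -> X) (p a : X) (c : R) (e : nat -> R) :
  hullpt s p -> (forall n, hinner (s n) a <= c + e n) -> Un_cv e 0 -> hinner p a <= c.
Proof.
  intros Hp K C. apply le_epsilon. intros d P. destruct (C d P) as [N HN].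
  apply (Hp _ _ N). intros n Hn. specialize (HN n Hn). unfold Rdist in HN.
  rewrite Rminus_0_r in HN. apply Rabs_def2 in HN. specialize (K n). lra.
Qed.

(** The index maps arising in [opial] satisfy just [n <= phi n], which already sends tails into
    tails. *)
Lemma Un_cv_subseq (u : nat -> R) (l : R) (phi : nat -> nat) :
  (forall n, (n <= phi n)%nat) -> Un_cv u l -> Un_cv (fun n => u (phi n)) l.
Proof.
  intros Hphi C e P. destruct (C e P) as [N HN]. exists N. intros n Hn. apply HN.
  specialize (Hphi n). lia.
Qed.

Lemma decrease_cv (E : nat -> R) :
  (forall k, 0 <= E k) -> (forall k, E (S k) <= E k) -> exists l, Un_cv E l.
Proof.
  intros P D. destruct (decreasing_cv E) as [l Hl]; [exact D| |exists l; exact Hl].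
  exists 0. intros r [n ->]. unfold opp_seq. specialize (P n). lra.
Qed.

Lemma decrease_vanish (X : Hilbert) (E : nat -> R) (c : R) (t : nat -> X) :
  0 < c -> (exists l, Un_cv E l) -> (forall k, E (S k) + c * hinner (t k) (t k) <= E k) ->
  vanish t.
Proof.
  intros Hc [l Hl] D. apply vanish_of_sq.
  apply (@Un_cv_squeeze0 _ (fun k => / c * (E k - E (S k)))).
  - intro k. rewrite Rabs_pos_eq by apply h_inner_pos. specialize (D k).
    apply (Rmult_le_reg_l c); [lra|].
    replace (c * (/ c * (E k - E (S k)))) with (E k - E (S k)) by (field; lra). lra.
  - replace 0 with (/ c * (l - l)) by ring. apply Un_cv_scal, CV_minus; [exact Hl|].
    apply (Un_cv_subseq (phi := S)); [intro; lia | exact Hl].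
Qed.

Lemma bdd_of_sq (X : Hilbert) (t : nat -> X) (M : R) :
  (forall k, hinner (t k) (t k) <= M) -> bdd t.
Proof.
  intro K. assert (M0 : 0 <= M) by (pose proof (K 0%nat); pose proof (h_inner_pos _ (t 0%nat)); lra).
  exists (sqrt M). intro k. apply hnorm_le; [apply sqrt_pos|]. rewrite sqrt_sqrt by exact M0.
  apply K.
Qed.

Lemma bdd_ext (X : Hilbert) (t u : nat -> X) : (forall k, t k = u k) -> bdd t -> bdd u.
Proof. intros E [M HM]. exists M. intro k. rewrite <- E. apply HM. Qed.

Lemma vanish_ext (X : Hilbert) (t u : nat -> X) : (forall k, t k = u k) -> vanish t -> vanish u.
Proof. intros E V. revert V. apply Un_cv_ext. intro n. rewrite E. reflexivity. Qed.

Lemma sq_bounded_norm (X Y : Hilbert) (B : X -> Y) (beta : R) : 0 <= beta ->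
  (forall z, hinner (B z) (B z) <= beta * hinner z z) ->
  forall z, hnorm (B z) <= sqrt beta * hnorm z.
Proof.
  intros P K z. pose proof (sqrt_pos beta). pose proof (hnorm_ge0 z).
  apply hnorm_le; [nra|]. eapply Rle_trans; [apply K|]. rewrite <- hnorm_sq.
  replace (sqrt beta * hnorm z * (sqrt beta * hnorm z))
    with ((sqrt beta * sqrt beta) * (hnorm z * hnorm z)) by ring.
  rewrite sqrt_sqrt by exact P. lra.
Qed.

Lemma pd_converges (X Y : Hilbert) (f : X -> R) (df : X -> X) (L : R) (g : X -> ERbar)
    (h : Y -> ERbar) (B : X -> Y) (Bs : Y -> X) (gamma s beta : R) (xh : X) (yh : Y)
    (x v : nat -> X) (y : nat -> Y) :
  splitting f df L g h B Bs -> saddle df g h B Bs xh yh ->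
  0 < gamma < 2 / L -> 0 < s -> 0 <= beta -> gamma * s * beta < 1 ->
  (forall z, hinner (B z) (B z) <= beta * hinner z z) ->
  (forall k, pd_step df g h B Bs gamma s (x k) (v k) (x (S k)) (y k) (y (S k))) ->
  exists xs ys, saddle df g h B Bs xs ys /\ weak_cv x xs.
Proof.
  intros SP S0 [Hg1 Hg2] Hs Hb Hgs HB Hst. pose proof (sp_adj SP) as A. pose proof (sp_L SP) as HL.
  assert (Hw : 0 < gamma / s) by (apply Rdiv_lt_0_compat; lra).
  (* [tau] lies strictly between [gamma * s] and [1 / beta] *)
  set (lam := gamma * s). assert (Hlam : 0 < lam) by (unfold lam; nra).
  fold lam in Hgs. assert (Hlb : 0 <= lam * beta) by nra.
  set (tau := 2 * lam / (1 + lam * beta)).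
  assert (Htau : 0 < tau) by (apply Rdiv_lt_0_compat; lra).
  assert (Etau : tau * (1 + lam * beta) = 2 * lam) by (unfold tau; field; lra).
  assert (c1 : 0 < 1 - gamma * L / 2).
  { apply (Rmult_lt_compat_r L) in Hg2; [|lra].
    replace (2 / L * L) with 2 in Hg2 by (field; lra). lra. }
  assert (c2 : 0 < 1 - tau * beta).
  { assert (tau * beta * (1 + lam * beta) = 2 * (lam * beta)) by (rewrite <- Rmult_assoc, <- Etau; ring).
    apply (Rmult_lt_reg_r (1 + lam * beta)); lra. }
  assert (c3 : 0 < gamma / s - gamma * gamma / tau).
  { assert (lam < tau) by (apply (Rmult_lt_reg_r (1 + lam * beta)); nra).
    replace (gamma / s - gamma * gamma / tau) with (gamma / (s * tau) * (tau - lam))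
      by (unfold lam; field; lra).
    apply Rmult_lt_0_compat; [apply Rdiv_lt_0_compat; nra | lra]. }
  (* The weight [gamma / s] makes [En xs ys k] the squared distance in [Z] from [sn k] to
     [(xs, ys)]. *)
  set (Z := wprod Hw X Y).
  set (sn := fun n => (x n, y n) : Z).
  set (En := fun xs ys k => hinner (hsub (x k) xs) (hsub (x k) xs)
               + gamma / s * hinner (hsub (y k) ys) (hsub (y k) ys)).
  assert (Fej : forall xs ys, saddle df g h B Bs xs ys -> forall k,
     En xs ys (S k) + (1 - gamma * L / 2) * hinner (hsub (x k) (v k)) (hsub (x k) (v k))
       + (1 - tau * beta) * hinner (hsub (v k) (x (S k))) (hsub (v k) (x (S k)))
       + (gamma / s - gamma * gamma / tau) * hinner (hsub (y (S k)) (y k)) (hsub (y (S k)) (y k))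
     <= En xs ys k).
  { intros xs ys Sa k. unfold En. apply (fejer_step SP Sa Hg1 Hs Htau HB (Hst k)). }
  assert (Epos : forall xs ys k, 0 <= En xs ys k).
  { intros xs ys k. apply Rplus_le_le_0_compat; [apply h_inner_pos|].
    apply Rmult_le_pos; [lra | apply h_inner_pos]. }
  assert (Fin3 : forall k, 0 <= (1 - gamma * L / 2) * hinner (hsub (x k) (v k)) (hsub (x k) (v k))
    /\ 0 <= (1 - tau * beta) * hinner (hsub (v k) (x (S k))) (hsub (v k) (x (S k)))
    /\ 0 <= (gamma / s - gamma * gamma / tau)
             * hinner (hsub (y (S k)) (y k)) (hsub (y (S k)) (y k))).
  { intro k. repeat split; (apply Rmult_le_pos; [lra | apply h_inner_pos]). }
  assert (Dec : forall xs ys, saddle df g h B Bs xs ys -> forall k, En xs ys (S k) <= En xs ys k).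
  { intros xs ys Sa k. pose proof (Fej _ _ Sa k). pose proof (Fin3 k). lra. }
  assert (Ecv : forall xs ys, saddle df g h B Bs xs ys -> exists l, Un_cv (En xs ys) l).
  { intros xs ys Sa. apply decrease_cv; [apply Epos | apply Dec, Sa]. }
  assert (E0 : forall k, En xh yh k <= En xh yh 0%nat).
  { induction k; [lra|]. pose proof (Dec _ _ S0 k). lra. }
  assert (Vxv : vanish (fun k => hsub (x k) (v k))).
  { apply (decrease_vanish c1 (Ecv _ _ S0)). intro k.
    pose proof (Fej _ _ S0 k). pose proof (Fin3 k). lra. }
  assert (Vy : vanish (fun k => hsub (y (S k)) (y k))).
  { apply (decrease_vanish c3 (Ecv _ _ S0)). intro k.
    pose proof (Fej _ _ S0 k). pose proof (Fin3 k). lra. }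
  assert (Bdx : bdd (fun k => hsub (x k) xh)).
  { apply (@bdd_of_sq _ _ (En xh yh 0%nat)). intro k. pose proof (E0 k) as Q. unfold En in Q at 1.
    pose proof (Rmult_le_pos _ _ (Rlt_le _ _ Hw) (h_inner_pos _ (hsub (y k) yh))). lra. }
  assert (By : bdd y).
  { apply (@bdd_ext _ (fun k => hadd (hsub (y k) yh) yh)); [intro k; vec|].
    apply bdd_add; [|apply bdd_const].
    apply (@bdd_of_sq _ _ (/ (gamma / s) * En xh yh 0%nat)). intro k.
    pose proof (E0 k) as Q. unfold En in Q at 1.
    pose proof (h_inner_pos _ (hsub (x k) xh)).
    apply (Rmult_le_reg_l (gamma / s)); [exact Hw|].
    rewrite <- Rmult_assoc, Rinv_r, Rmult_1_l by lra. lra. }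
  assert (Bx : bdd x).
  { apply (@bdd_ext _ (fun k => hadd (hsub (x k) xh) xh)); [intro k; vec|].
    apply bdd_add; [exact Bdx | apply bdd_const]. }
  assert (Bv : bdd v).
  { apply (@bdd_ext _ (fun k => hadd (x k) (hscal (-1) (hsub (x k) (v k))))); [intro k; vec|].
    apply bdd_add; [exact Bx | apply bdd_scal, vanish_bdd, Vxv]. }
  assert (Bdf : bdd (fun k => df (x k))).
  { apply (@bdd_ext _ (fun k => hadd (hsub (df (x k)) (df xh)) (df xh))); [intro k; vec|].
    apply bdd_add; [|apply bdd_const]. destruct Bdx as [M HM]. exists (L * M). intro k.
    eapply Rle_trans; [apply (sp_lip SP)|]. apply Rmult_le_compat_l; [lra | apply HM]. }
  pose proof (sq_bounded_norm Hb HB) as NB. pose proof (sqrt_pos beta) as SB.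
  set (q := fun k => dual_pt s B (v k) (y k) (y (S k))).
  assert (VqB : vanish (fun k => hsub (q k) (B (v k)))).
  { apply (@vanish_ext _ (fun k => hscal (- / s) (hsub (y (S k)) (y k)))).
    - intro k. apply hext. intro z. unfold q, dual_pt. hexp. field. lra.
    - apply vanish_scal, Vy. }
  assert (VBq : vanish (fun k => hsub (B (x k)) (q k))).
  { apply (@vanish_ext _ (fun k => hadd (B (hsub (x k) (v k))) (hscal (-1) (hsub (q k) (B (v k)))))).
    - intro k. rewrite (adjoint_sub _ _ A). vec.
    - apply vanish_add; [|apply vanish_scal, VqB].
      apply (@Un_cv_squeeze0 _ (fun k => sqrt beta * hnorm (hsub (x k) (v k)))).
      + intro k. rewrite Rabs_pos_eq by apply hnorm_ge0. apply NB.
      + rewrite <- (Rmult_0_r (sqrt beta)). apply Un_cv_scal, Vxv. }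
  assert (Bq : bdd q).
  { apply (@bdd_ext _ (fun k => hadd (hsub (q k) (B (v k))) (B (v k)))); [intro k; vec|].
    apply bdd_add; [apply vanish_bdd, VqB|]. destruct Bv as [M HM]. exists (sqrt beta * M).
    intro k. eapply Rle_trans; [apply NB|]. apply Rmult_le_compat_l; [exact SB | apply HM]. }
  destruct (@opial Z sn (fun p => saddle df g h B Bs (fst p) (snd p))) as [p [Sp Wp]].
  - apply (@bdd_ext Z (fun k => hadd (hsub (sn k) ((xh, yh) : Z)) ((xh, yh) : Z)));
      [intro k; vec|].
    apply bdd_add; [|apply bdd_const]. apply (@bdd_of_sq Z _ (En xh yh 0%nat)). exact E0.
  - intros [xs ys] Sa. exact (Ecv _ _ Sa).
  - intros phi [xs ys] Hphi Hp. simpl. apply (saddle_of_gap SP S0).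
    intros a z0 u0 b0 q0 w0 c0 z b r c S1 E1 S2 E2 Eb Ec.
    set (e := fun k => hinner u0 (hsub (x k) (v k)) + hinner w0 (hsub (B (x k)) (q k))
       + hinner (df (x k)) (hsub (x k) (v k))
       + / gamma * hinner (hsub (v k) z) (hsub (x k) (v k)) + hinner (y k) (hsub (q k) (B (v k)))
       + hinner (hsub (q k) r) (hsub (y (S k)) (y k))).
    assert (Ce : Un_cv e 0).
    { replace 0 with (0 + 0 + 0 + / gamma * 0 + 0 + 0) by ring.
      repeat apply CV_plus.
      - apply bdd_inner_vanish; [apply bdd_const | exact Vxv].
      - apply bdd_inner_vanish; [apply bdd_const | exact VBq].
      - apply bdd_inner_vanish; [exact Bdf | exact Vxv].
      - apply Un_cv_scal, bdd_inner_vanish; [|exact Vxv].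
        apply (@bdd_ext _ (fun k => hadd (v k) (hopp z))); [reflexivity|].
        apply bdd_add; [exact Bv | apply bdd_const].
      - apply bdd_inner_vanish; [exact By | exact VqB].
      - apply bdd_inner_vanish; [|exact Vy].
        apply (@bdd_ext _ (fun k => hadd (q k) (hopp r))); [reflexivity|].
        apply bdd_add; [exact Bq | apply bdd_const]. }
    (* The gap inequality becomes the half-space [<(x, y), av> <= k0] of [Z]. The second component
       of [av] is divided by the weight that the inner product of [Z] multiplies back. *)
    set (av := (hadd (hadd (df a) u0) (Bs w0), hscal (/ (gamma / s)) (hsub r (B z))) : Z).
    set (k0 := f z + b + c - (f a - hinner (df a) a + (b0 - hinner u0 z0) + (c0 - hinner w0 q0))).
    assert (Ein : forall (x1 : X) (y1 : Y), hinner ((x1, y1) : Z) av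
      = hinner (hadd (hadd (df a) u0) (Bs w0)) x1 + hinner y1 (hsub r (B z))).
    { intros x1 y1. unfold av. simpl. rewrite inner_scalr, h_innerC.
      rewrite <- Rmult_assoc, Rinv_r by lra. ring. }
    assert (Lim : hinner ((xs, ys) : Z) av <= k0).
    { apply (hullpt_limit_le Hp (e := fun n => e (phi n))); [|apply Un_cv_subseq; assumption].
      intro n. change (sn (phi n)) with ((x (phi n), y (phi n)) : Z). rewrite Ein.
      pose proof (gap_step a SP Hg1 (Hst (phi n)) S1 E1 S2 E2 Eb Ec) as G. cbv zeta in G.
      fold (q (phi n)) in G. fold (e (phi n)) in G. revert G. unfold k0.
      generalize (e (phi n)). intro e1. hexp. rewrite !(adjoint_swap A). lra. }
    rewrite Ein in Lim. revert Lim. unfold k0. hexp. rewrite !(adjoint_swap A). lra.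
  - exists (fst p), (snd p). split; [exact Sp|]. intro z.
    (* Testing against [(z, 0)] projects weak convergence onto the first component. *)
    pose proof (Wp ((z, hzero) : Z)) as C. simpl in C. rewrite inner_0r, Rmult_0_r, Rplus_0_r in C.
    revert C. apply Un_cv_ext. intro n. rewrite inner_0r. ring.
Qed.

(** * Finite products *)

Lemma op_norm_bound (X Y : Hilbert) (B : X -> Y) (x : X) : bounded_linear B ->
  hinner (B x) (B x) <= op_norm B ^ 2 * hinner x x.
Proof.
  intro HB. destruct (bounded_linear_pos HB) as (C & C0 & HC). destruct HB as (_ & HZ & _).
  (* Boundedness of [B] ensures that the supremum chosen in [op_norm] exists. *)
  assert (Lub : is_lub (fun t => exists z, hnorm z <= 1 /\ t = hnorm (B z)) (op_norm B)).
  { unfold op_norm. apply epsilon_spec.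
    destruct (completeness (fun t => exists z, hnorm z <= 1 /\ t = hnorm (B z))) as [r Hr].
    - exists C. intros t (z & Lz & ->). specialize (HC z). pose proof (hnorm_ge0 z). nra.
    - exists (hnorm (B hzero)), hzero. split; [rewrite hnorm_0; lra | reflexivity].
    - exists r. exact Hr. }
  destruct Lub as [U _].
  pose proof (hnorm_ge0 x) as N. rewrite <- !hnorm_sq.
  assert (K : hnorm (B x) <= op_norm B * hnorm x).
  { destruct (Req_dec (hnorm x) 0) as [Z|Z].
    - specialize (HC x). rewrite Z in *. lra.
    - assert (Q : hnorm (B (hscal (/ hnorm x) x)) <= op_norm B).
      { apply U. exists (hscal (/ hnorm x) x). split; [|reflexivity].
        rewrite hnorm_scal, Rabs_inv, (Rabs_pos_eq _ N), Rinv_l by exact Z. lra. }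
      rewrite HZ, hnorm_scal, Rabs_inv, (Rabs_pos_eq _ N) in Q.
      apply (Rmult_le_compat_r (hnorm x)) in Q; [|exact N].
      replace (/ hnorm x * hnorm (B x) * hnorm x) with (hnorm (B x)) in Q by (field; exact Z).
      exact Q. }
  pose proof (hnorm_ge0 (B x)).
  replace (op_norm B ^ 2 * (hnorm x * hnorm x))
    with ((op_norm B * hnorm x) * (op_norm B * hnorm x)) by ring.
  apply Rmult_le_compat; assumption.
Qed.

Fixpoint prodG (G : nat -> Hilbert) (m : nat) : Hilbert :=
  match m with O => trivH | S n => wprod Rlt_0_1 (prodG G n) (G n) end.

Fixpoint tup (G : nat -> Hilbert) (m : nat) (y : forall i, G i) : prodG G m :=
  match m return prodG G m with O => tt | S n => (tup n y, y n) end.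

Fixpoint hprod (G : nat -> Hilbert) (h : forall i, G i -> ERbar) (m : nat) : prodG G m -> ERbar :=
  match m return prodG G m -> ERbar with
  | O => fun _ => Fin 0
  | S n => fun p => eadd (hprod h (m := n) (fst p)) (h n (snd p))
  end.

Fixpoint adjprod (H : Hilbert) (G : nat -> Hilbert) (Bs : forall i, G i -> H) (m : nat) :
    prodG G m -> H :=
  match m return prodG G m -> H with
  | O => fun _ => hzero
  | S n => fun p => hadd (adjprod Bs (m := n) (fst p)) (Bs n (snd p))
  end.

Lemma hprod_tup (G : nat -> Hilbert) (h : forall i, G i -> ERbar) (m : nat) (y : forall i, G i) :
  hprod h (tup m y) = esum m (fun i => h i (y i)).
Proof. induction m as [|n IH]; simpl; [reflexivity | rewrite IH; reflexivity]. Qed.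

Lemma adjprod_tup (H : Hilbert) (G : nat -> Hilbert) (Bs : forall i, G i -> H) (m : nat)
    (y : forall i, G i) : adjprod Bs (tup m y) = hsum m (fun i => Bs i (y i)).
Proof. induction m as [|n IH]; simpl; [reflexivity | rewrite IH; reflexivity]. Qed.

Lemma subdiff_tup (G : nat -> Hilbert) (h : forall i, G i -> ERbar) (m : nat)
    (q w : forall i, G i) :
  (forall i, (i < m)%nat -> subdiff (h i) (q i) (w i)) -> subdiff (@hprod G h m) (tup m q) (tup m w).
Proof.
  induction m as [|n IH]; intro K.
  - exists 0. split; [reflexivity|]. intros []. simpl. lra.
  - destruct IH as (a & Ea & Sa); [intros; apply K; lia|].
    destruct (K n (Nat.lt_succ_diag_r n)) as (b & Eb & Sb).
    exists (a + b). split; [simpl; rewrite Ea, Eb; reflexivity|]. intros [p z].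
    simpl hprod. specialize (Sa p). specialize (Sb z).
    destruct (hprod h p) as [c|], (h n z) as [d|]; try exact I. simpl in *.
    unfold hsub in Sa, Sb. lra.
Qed.

(** Subgradients of the factors assemble into one of the separable sum. The given [w] supplies the
    starting minorant for [sup_of_minorants_add] at each stage. *)
Lemma sup_of_minorants_hprod (G : nat -> Hilbert) (h : forall i, G i -> ERbar) (m : nat)
    (q w : forall i, G i) :
  (forall i, (i < m)%nat -> sup_of_minorants (h i)) ->
  (forall i, (i < m)%nat -> subdiff (h i) (q i) (w i)) -> sup_of_minorants (@hprod G h m).
Proof.
  induction m as [|n IH]; intros Hs Hq.
  - intros x M K. specialize (K tt tt 0). simpl in *.
    assert (0 + 0 <= M); [|lra]. apply K; [|reflexivity].
    exists 0. split; [reflexivity|]. intros []. simpl. lra.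
  - intros [x z] M K. simpl hprod.
    apply (sup_of_minorants_add (q1 := q n) (w1 := w n)).
    + apply IH; intros; [apply Hs | apply Hq]; lia.
    + apply Hs. lia.
    + apply Hq. lia.
    + intros p u b p' u' b' (b1 & E1 & S1) E (b2 & E2 & S2) E'.
      rewrite E in E1. injection E1 as <-. rewrite E' in E2. injection E2 as <-.
      specialize (K (p, p') (u, u') (b + b')). simpl in K. unfold hsub in *.
      assert (b + b' + (hinner u (hadd x (hopp p)) + 1 * hinner u' (hadd z (hopp p'))) <= M);
        [|lra].
      apply K; [|rewrite E, E'; reflexivity].
      exists (b + b'). split; [simpl; rewrite E, E'; reflexivity|]. intros [r r'].
      specialize (S1 r). specialize (S2 r'). simpl.
      destruct (hprod h r) as [c|], (h n r') as [d|]; try exact I. simpl in *. lra.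
Qed.

Lemma adjoint_prod (H : Hilbert) (G : nat -> Hilbert) (B : forall i, H -> G i)
    (Bs : forall i, G i -> H) (m : nat) :
  (forall i, (i < m)%nat -> is_adjoint (B i) (Bs i)) ->
  is_adjoint (fun x => tup m (fun i => B i x)) (@adjprod H G Bs m).
Proof.
  induction m as [|n IH]; intros A x y.
  - simpl. rewrite inner_0r. reflexivity.
  - destruct y as [p z]. simpl. rewrite inner_addr, Rmult_1_l. f_equal.
    + apply IH. intros. apply A. lia.
    + apply A. lia.
Qed.

Lemma tup_norm_bound (H : Hilbert) (G : nat -> Hilbert) (B : forall i, H -> G i) (m : nat) (x : H) :
  (forall i, (i < m)%nat -> bounded_linear (B i)) ->
  hinner (tup m (fun i => B i x)) (tup m (fun i => B i x))
    <= rsum m (fun i => op_norm (B i) ^ 2) * hinner x x.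
Proof.
  induction m as [|n IH]; intro K; [simpl; lra|].
  assert (I1 := IH (fun i Hi => K i (Nat.lt_lt_succ_r _ _ Hi))).
  pose proof (op_norm_bound x (K n (Nat.lt_succ_diag_r n))) as I2.
  change (rsum (S n) (fun i => op_norm (B i) ^ 2))
    with (rsum n (fun i => op_norm (B i) ^ 2) + op_norm (B n) ^ 2).
  change (hinner (tup (S n) (fun i => B i x)) (tup (S n) (fun i => B i x)))
    with (hinner (tup n (fun i => B i x)) (tup n (fun i => B i x)) + 1 * hinner (B n x) (B n x)).
  lra.
Qed.

Lemma rsum_sq_ge0 (m : nat) (F : nat -> R) : 0 <= rsum m (fun i => F i ^ 2).
Proof.
  induction m as [|n IH]; [simpl; lra|].
  change (0 <= rsum n (fun i => F i ^ 2) + F n ^ 2). pose proof (pow2_ge_0 (F n)). lra.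
Qed.

Lemma dual_pt_tup (H : Hilbert) (G : nat -> Hilbert) (B : forall i, H -> G i) (m : nat) (s : R)
    (v : H) (y y' : forall i, G i) :
  dual_pt s (fun x => tup m (fun i => B i x)) v (tup m y) (tup m y')
    = tup m (fun i => dual_pt s (B i) v (y i) (y' i)).
Proof.
  induction m as [|n IH]; [reflexivity|]. exact (f_equal2 pair IH eq_refl).
Qed.

(** * Reduction of the scheme with [m] operators to the stacked one *)

Theorem theorem4p4
  (H : Hilbert) (m : nat) (G : nat -> Hilbert)
  (f : H -> R) (gradf : H -> H) (L : R)
  (g : H -> ERbar) (h : forall i, G i -> ERbar)
  (B : forall i, H -> G i) (Bs : forall i, G i -> H)
  (* standing assumptions *)
  (HL : 0 < L)
  (Hfconv : forall x y t, 0 < t < 1 ->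
      f (hadd (hscal t x) (hscal (1 - t) y)) <= t * f x + (1 - t) * f y)
  (Hgrad : is_gradient f gradf)
  (Hlip : lipschitz L gradf)
  (Hg : Gamma0 g)
  (Hh : forall i, (i < m)%nat -> Gamma0 (h i))
  (HB : forall i, (i < m)%nat -> bounded_linear (B i))
  (HBs : forall i, (i < m)%nat -> is_adjoint (B i) (Bs i))
  (Hsol : exists (xh : H) (u : H) (w : forall i, G i),
      subdiff g xh u /\
      (forall i, (i < m)%nat -> subdiff (h i) (B i xh) (w i)) /\
      hadd (hadd (gradf xh) u) (hsum m (fun i => Bs i (w i))) = hzero)
  (* parameters *)
  (gamma lambda : R)
  (Hgamma : 0 < gamma < 2 / L)
  (Hlambda : 0 < lambda /\ lambda * rsum m (fun i => (op_norm (B i))^2) < 1)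
  (* iterates (x 0 and y 0 are arbitrary) *)
  (x v : nat -> H) (y : nat -> forall i, G i)
  (Hv : forall k, v k = prox gamma g
          (hsub (hsub (x k) (hscal gamma (gradf (x k))))
                (hscal gamma (hsum m (fun i => Bs i (y k i))))))
  (Hy : forall k i, (i < m)%nat -> y (S k) i =
          prox (lambda / gamma) (fconj (h i))
            (hadd (y k i) (hscal (lambda / gamma) (B i (v k)))))
  (Hx : forall k, x (S k) = prox gamma g
          (hsub (hsub (x k) (hscal gamma (gradf (x k))))
                (hscal gamma (hsum m (fun i => Bs i (y (S k) i)))))) :
  exists xs : H,
    (forall z : H,
       ele (eadd (Fin (f xs)) (eadd (g xs) (esum m (fun i => h i (B i (xs))))))
           (eadd (Fin (f z)) (eadd (g z) (esum m (fun i => h i (B i z)))))) /\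
    weak_cv x xs.
Proof.
  destruct Hsol as (xh & u & w & Su & Sw & Opt). destruct Hlambda as [Hl1 Hl2].
  destruct Hgamma as [Hg1 Hg2].
  (* The dual step size: [gamma * s] is [lambda], and the weight [gamma / s] is
     [gamma^2 / lambda]. *)
  set (s := lambda / gamma). assert (Hs : 0 < s) by (apply Rdiv_lt_0_compat; lra).
  set (Bp := fun z => tup m (fun i => B i z)).
  assert (SP : splitting f gradf L g (@hprod G h m) Bp (@adjprod H G Bs m)).
  { constructor; try assumption.
    - apply Hg.
    - exact (Gamma0_sup_of_minorants Hg Su).
    - apply (sup_of_minorants_hprod (q := fun i => B i xh) (w := w)); [|exact Sw].
      intros i Hi. exact (Gamma0_sup_of_minorants (Hh i Hi) (Sw i Hi)).
    - apply adjoint_prod, HBs. }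
  assert (S0 : saddle gradf g (@hprod G h m) Bp (@adjprod H G Bs m) xh (tup m w)).
  { split; [|exact (subdiff_tup Sw)]. rewrite adjprod_tup.
    (* The optimality equation determines [u] as the negative of the gradient plus the adjoint
       terms. *)
    replace (hopp (hadd (gradf xh) (hsum m (fun i => Bs i (w i))))) with u; [exact Su|].
    apply hext. intro z. pose proof (f_equal (fun t => hinner t z) Opt) as E.
    revert E. cbv beta. hexp. lra. }
  assert (Bp_bound : forall z, hinner (Bp z) (Bp z) <= rsum m (fun i => op_norm (B i) ^ 2) * hinner z z)
    by (intro z; apply tup_norm_bound, HB).
  assert (Hst : forall k, pd_step gradf g (@hprod G h m) Bp (@adjprod H G Bs m) gamma s
     (x k) (v k) (x (S k)) (tup m (y k)) (tup m (y (S k)))).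
  { intro k. constructor.
    - unfold fb_arg. rewrite adjprod_tup, Hv. exact (prox_subdiff _ Hg1 Hg Su).
    (* The dual update acts on each component separately, so Moreau's decomposition applies to each
       [h i] alone. *)
    - unfold Bp. rewrite dual_pt_tup. apply subdiff_tup. intros i Hi. unfold dual_pt.
      rewrite (Hy k i Hi). exact (prox_fconj_subdiff _ Hs (Hh i Hi) (Sw i Hi)).
    - unfold fb_arg. rewrite adjprod_tup, Hx. exact (prox_subdiff _ Hg1 Hg Su). }
  assert (Hgs : gamma * s * rsum m (fun i => op_norm (B i) ^ 2) < 1).
  { replace (gamma * s) with lambda by (unfold s; field; lra). exact Hl2. }
  destruct (pd_converges SP S0 (conj Hg1 Hg2) Hs (rsum_sq_ge0 m (fun i => op_norm (B i)))
              Hgs Bp_bound Hst) as (xs & ys & Sxs & Cxs).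
  exists xs. split; [|exact Cxs]. intro z.
  rewrite <- !(hprod_tup h). exact (saddle_minimizes SP Sxs z).
Qed.
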